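(* Assume each $f_k$ ($k=1,\dots,n$) is $L_k$-smooth and $\mu_k$-strongly convex ($\mu_k\ge0$). Let $L=\max_kL_k$, $\mu=\min_k\mu_k$. Start from $\mathbf x_0$ with $\|\mathbf x_0-\mathbf x^*\|\le B$ and let $F=\mathbb E[f(\mathbf x_0)-f(\mathbf x^* )]$. Run Local SVRG for $S$ stages, each with $m$ iterations, with $\mathrm{gap}(\mathcal I_m)=E$ ($1\le E\le m$) and an appropriately tuned constant learning rate $\eta\le\Theta(\frac1{LE})$, and let $T=mS$. Then the output $\hat{\mathbf x}$ satisfies: if $\mu=0$, $$\mathbb E[f(\hat{\mathbf x})-f(\mathbf x^* )]=O\Big(\frac{LEB^2}{T}+\frac FS\Big),$$ and if $\mu>0$, with $\kappa=L/\mu$, $$\mathbb E[f(\hat{\mathbf x})-f(\mathbf x^* )]=O\Big([LEB^2+F]\cdot\exp\Big(-\Theta\Big(\frac{T}{\max\{\kappa E,m\}}\Big)\Big)\Big),$$ no matter whether the data distributions $\mathcal D_1,\dots,\mathcal D_n$ are identical or not.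
   Context: There are $n$ machines; machine $k$ has data distribution $\mathcal D_k$ and local objective $f_k(\mathbf x)=\mathbb E_{\xi\sim\mathcal D_k}f(\mathbf x;\xi)$ on $\mathbb R^d$. The global objective is $f(\mathbf x)=\frac1n\sum_{k=1}^nf_k(\mathbf x)$ with minimizer $\mathbf x^*$ (assumed to exist). ''$f_k$ is $L_k$-smooth'' means that for every sample $\xi$ of $\mathcal D_k$, $f(\cdot;\xi)$ is convex, differentiable, with $L_k$-Lipschitz gradient; ''$\mu_k$-strongly convex'' means $f_k(\mathbf y)-f_k(\mathbf x)\ge\langle\nabla f_k(\mathbf x),\mathbf y-\mathbf x\rangle+\frac{\mu_k}2\|\mathbf x-\mathbf y\|^2$ for all $\mathbf x,\mathbf y$; $\nabla f_k(\mathbf x)=\mathbb E_{\xi\sim\mathcal D_k}\nabla f(\mathbf x;\xi)$. Local SVRG: initialize $\widetilde{\mathbf x}_0=\mathbf x_{0,0}^{(k)}=\mathbf x_0$ for all $k$. For stages $s=0,\dots,S-1$: put $\widetilde{\mathbf h}_s=\frac1n\sum_{k=1}^n\nabla f_k(\widetilde{\mathbf x}_s)$; for $t=0,\dots,m-1$ each machine $k$ samples $\xi_{t,s}^{(k)}\sim\mathcal D_k$ (all samples independent), sets $\mathbf g_{t,s}^{(k)}=\nabla f(\mathbf x_{t,s}^{(k)};\xi_{t,s}^{(k)})-\nabla f(\widetilde{\mathbf x}_s;\xi_{t,s}^{(k)})+\widetilde{\mathbf h}_s$ and $\mathbf x_{t+1,s}^{(k)}=\mathbf x_{t,s}^{(k)}-\eta\,\mathbf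 g_{t,s}^{(k)}$; if $t+1\in\mathcal I_m$, every $\mathbf x_{t+1,s}^{(k)}$ is replaced by $\frac1n\sum_{j=1}^n\mathbf x_{t+1,s}^{(j)}$. At the end of the stage set $\mathbf x_{0,s+1}^{(k)}=\frac1n\sum_{j=1}^n\mathbf x_{m,s}^{(j)}$ for all $k$ and $\widetilde{\mathbf x}_{s+1}=\Big(\sum_{i=0}^{m-1}(1-\mu\eta)^i\frac1n\sum_{k=1}^n\mathbf x_{m-i-1,s}^{(k)}\Big)\Big/\sum_{j=0}^{m-1}(1-\mu\eta)^j$. Output $\hat{\mathbf x}=\frac1S\sum_{s=1}^S\widetilde{\mathbf x}_s$ if $\mu=0$, and $\hat{\mathbf x}=\widetilde{\mathbf x}_S$ otherwise. $\mathrm{gap}(\mathcal I_m)$ is the largest difference between consecutive elements of $\mathcal I_m\subset[m]$ in sorted order, where $0$ and $m$ are counted as elements. $O,\Theta$ hide absolute constants. *)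

(* Defs.v *)
From HB Require Import structures.
From mathcomp Require Import all_boot all_order all_algebra.
From mathcomp Require Import all_classical all_reals all_analysis.
Set Implicit Arguments.
Unset Strict Implicit.
Unset Printing Implicit Defensive.
Import Order.TTheory GRing.Theory Num.Theory.
Import numFieldNormedType.Exports.
Local Open Scope classical_set_scope.
Local Open Scope ring_scope.

Section Euclidean.
Context {R : realType} {d : nat}.
Implicit Types (u v x y : 'rV[R]_d) (g : 'rV[R]_d -> R).

(* The library norm `|x| on 'rV[R]_d is the sup norm, hence [enorm]. *)
Definition dotp u v : R := \sum_(i < d) u 0 i * v 0 i.
Definition enorm u : R := Num.sqrt (dotp u u).

Definition gradient g x : 'rV[R]_d := \row_(i < d) 'D_(delta_mx 0 i) g x.

Definition convex_smooth (L : R) g : Prop :=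
  [/\ convex_function (setT : set 'rV[R]_d) g,
      forall x, differentiable g x
    & forall x y, enorm (gradient g x - gradient g y) <= L * enorm (x - y)].

Definition strongly_convex (mu : R) g : Prop :=
  forall x y, dotp (gradient g x) (y - x) + mu / 2 * enorm (x - y) ^+ 2
              <= g y - g x.

Definition minimizer g x : Prop := forall y, g x <= g y.

End Euclidean.

Definition borel_rV (R : realType) (d : nat) :=
  g_sigma_algebraType [set U : set 'rV[R]_d | open U].

(* [G i] is meant to be a sigma-algebra of events for every [i]. *)
Definition mutually_independent {dO} {Omega : measurableType dO} {R : realType}
    (P : probability Omega R) (I : finType) (G : I -> set (set Omega)) : Prop :=
  forall (J : {set I}) (A : I -> set Omega),
    (forall i, i \in J -> G i (A i)) ->
    (P (\bigcap_(i in [set` J]) A i) = \prod_(i in J) P (A i))%E.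

Definition gap (m : nat) (I : pred nat) : nat :=
  let s := [seq t <- iota 0 m.+1 | [|| t == 0%N, t == m | I t]] in
  \max_(p <- zip s (behead s)) (p.2 - p.1)%N.

(* There are n.+1 machines, indexed by 'I_n.+1.  Machine k draws its samples
   from its own sample space Xi k with law D k, and [f k x z] is the loss at x
   of the sample z of machine k.  A loss common to all machines is the special
   case of a constant family Xi and an f not depending on k. *)
Section LocalSVRG.
Context {R : realType} {n d : nat} {dX : measure_display}.
Context {Xi : 'I_n.+1 -> measurableType dX}.
Variable D : forall k, probability (Xi k) R.
Variable f : forall k, 'rV[R]_d -> Xi k -> R.

Definition local_objective k (x : 'rV[R]_d) : R := \int[D k]_z f x z.

Definition objective (x : 'rV[R]_d) : R :=
  n.+1%:R^-1 * \sum_k local_objective k x.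

Definition sample_gradient k (x : 'rV[R]_d) (z : Xi k) : 'rV[R]_d :=
  gradient (fun y => f y z) x.

(* The expectations defining f_k and E[grad f(x; xi)] exist, and the latter is
   grad f_k(x). *)
Definition stochastic_oracle k : Prop :=
  forall x : 'rV[R]_d,
    [/\ (D k).-integrable setT (EFin \o f x),
        forall i, (D k).-integrable setT
                    (EFin \o (fun z => sample_gradient x z 0 i))
      & gradient (local_objective k) x
        = \row_(i < d) \int[D k]_z sample_gradient x z 0 i].

Definition average (v : 'I_n.+1 -> 'rV[R]_d) : 'rV[R]_d :=
  n.+1%:R^-1 *: \sum_k v k.

Variables (m : nat) (I : pred nat) (mu eta : R).

(* [local_iterate xt y z t k] is the iterate of machine k after t steps of a
   stage with reference point xt and common starting point y, where z k t is
   the sample used by machine k at step t. *)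
Fixpoint local_iterate (xt y : 'rV[R]_d) (z : forall k, nat -> Xi k) (t : nat)
    : 'I_n.+1 -> 'rV[R]_d :=
  match t with
  | 0%N => fun=> y
  | t'.+1 =>
      let x := local_iterate xt y z t' in
      let h := average (fun k => gradient (local_objective k) xt) in
      let g k := sample_gradient (x k) (z k t')
                 - sample_gradient xt (z k t') + h in
      let x' k := x k - eta *: g k in
      if I t'.+1 then fun=> average x' else x'
  end.

Definition next_reference (x : nat -> 'I_n.+1 -> 'rV[R]_d) : 'rV[R]_d :=
  (\sum_(j < m) (1 - mu * eta) ^+ j)^-1 *:
    \sum_(i < m) (1 - mu * eta) ^+ i *: average (x (m - i - 1)%N).

(* The pair (reference point, common starting point) of stage s;
   z k s t is the sample used by machine k at step t of stage s. *)
Fixpoint stage (x0 : 'rV[R]_d) (z : forall k, nat -> nat -> Xi k) (s : nat)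
    : 'rV[R]_d * 'rV[R]_d :=
  match s with
  | 0%N => (x0, x0)
  | s'.+1 =>
      let p := stage x0 z s' in
      let x := local_iterate p.1 p.2 (fun k => z k s') in
      (next_reference x, average (x m))
  end.

Definition svrg_output (S : nat) (x0 : 'rV[R]_d)
    (z : forall k, nat -> nat -> Xi k) : 'rV[R]_d :=
  if mu == 0 then S%:R^-1 *: \sum_(1 <= s < S.+1) (stage x0 z s).1
  else (stage x0 z S).1.

End LocalSVRG.

Section Sampling.
Context {R : realType} {n d : nat} {dX dO : measure_display}.
Context {Xi : 'I_n.+1 -> measurableType dX} {Omega : measurableType dO}.

(* The events generated by x_0 (index None) and by each sample. *)
Definition source_events (S m : nat) (x0 : Omega -> borel_rV R d)
    (xi : forall k, nat -> nat -> Omega -> Xi k)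
    (i : option ('I_n.+1 * 'I_S * 'I_m)) : set (set Omega) :=
  match i with
  | None => preimage_set_system setT x0 measurable
  | Some (k, s, t) => preimage_set_system setT (xi k s t) measurable
  end.

(* The starting point may be random; it is independent of the samples. *)
Definition independent_sampling (P : probability Omega R)
    (D : forall k, probability (Xi k) R) (S m : nat)
    (x0 : Omega -> borel_rV R d)
    (xi : forall k, nat -> nat -> Omega -> Xi k) : Prop :=
  [/\ measurable_fun setT x0,
      forall k s t, (s < S)%N -> (t < m)%N -> measurable_fun setT (xi k s t),
      forall k s t, (s < S)%N -> (t < m)%N ->
        forall A, measurable A -> P (xi k s t @^-1` A) = D k A
    & mutually_independent P (@source_events S m x0 xi)].

End Sampling.

(* Main.v *)
(* With xs the minimizer, x_k the local iterates of a stage, xb their average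
   and V their mean squared deviation from xb, the potential |xb - xs|^2 + w_j V
   contracts in expectation by the factor 1 - mu eta at each step, up to a gain
   (3/2) eta (f(xb) - f(xs)) and a loss (1/2) eta (f(xt) - f(xs)), xt being the
   reference point. Here j counts the local steps since the last synchronization and
   w_j = 16 eta L (2 E - j): the linear decrease of w_j pays for the growth of V,
   so no sum over a synchronization window is needed. Heterogeneity is harmless
   because the variance-reduced gradients are bounded by co-coercivity through
   Bregman divergences of the f_k at xs, whose average is f - f(xs) as
   grad f(xs) = 0. Unrolling over a stage with the weights (1 - mu eta)^i
   and using convexity at the next reference point gives
     a_(s+1) + (3/2) c d_(s+1) <= (1 - mu eta)^m a_s + (1/2) c d_s
   for the expected squared distances a_s and reference gaps d_s, which is
   telescoped when mu = 0 and iterated when mu > 0.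
   The expectation of a step is computed by Fubini: the state is measurable for
   the sigma-algebra of the past sources, which is independent of the fresh
   sample. Since sampled gradient differences are Lipschitz, truncating the
   initial point on a null event makes every iterate bounded. *)

Require Import Defs.
From HB Require Import structures.
From mathcomp Require Import all_boot all_order all_algebra.
From mathcomp Require Import all_classical all_reals all_analysis.
From mathcomp Require Import measurable_realfun.
From mathcomp Require Import ring lra.
Set Implicit Arguments.
Unset Strict Implicit.
Unset Printing Implicit Defensive.
Import Order.TTheory GRing.Theory Num.Theory.
Import numFieldNormedType.Exports.
Local Open Scope classical_set_scope.
Local Open Scope ring_scope.

(** * Euclidean vectors, means, smooth convex functions *)

Section DotProduct.
Context {R : realType} {d : nat}.
Implicit Types u v w x y : 'rV[R]_d.

Definition sqn u : R := dotp u u.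

Lemma dotpC u v : dotp u v = dotp v u.
Proof. by apply: eq_bigr => i _; rewrite mulrC. Qed.

Lemma dotpDl u v w : dotp (u + v) w = dotp u w + dotp v w.
Proof. by rewrite -big_split; apply: eq_bigr => i _; rewrite mxE mulrDl. Qed.

Lemma dotpZl a u v : dotp (a *: u) v = a * dotp u v.
Proof. by rewrite mulr_sumr; apply: eq_bigr => i _; rewrite mxE mulrA. Qed.

Lemma dotpNl u v : dotp (- u) v = - dotp u v.
Proof. by rewrite -scaleN1r dotpZl mulN1r. Qed.

Lemma dotpDr u v w : dotp w (u + v) = dotp w u + dotp w v.
Proof. by rewrite dotpC dotpDl !(dotpC w). Qed.

Lemma dotpZr a u v : dotp v (a *: u) = a * dotp v u.
Proof. by rewrite dotpC dotpZl dotpC. Qed.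

Lemma dotpNr u v : dotp v (- u) = - dotp v u.
Proof. by rewrite dotpC dotpNl dotpC. Qed.

Definition dotpE := (dotpDl, dotpDr, dotpNl, dotpNr, dotpZl, dotpZr).

Lemma dotp0l u : dotp 0 u = 0.
Proof. by rewrite -(scale0r 0) dotpZl mul0r. Qed.

Lemma dotp_suml (I : finType) (F : I -> 'rV[R]_d) u :
  dotp (\sum_i F i) u = \sum_i dotp (F i) u.
Proof.
by apply: (big_morph (dotp^~ u)) => [a b|]; rewrite ?dotpDl ?dotp0l.
Qed.

Lemma sqn_ge0 u : 0 <= sqn u.
Proof. by apply: sumr_ge0 => i _; exact: sqr_ge0. Qed.

Lemma sqn0 : sqn 0 = 0.
Proof. exact: dotp0l. Qed.

Lemma sqn_eq0 u : sqn u <= 0 -> u = 0.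
Proof.
move=> u0; apply/rowP => i; rewrite mxE; apply/eqP.
have : sqn u == 0 by rewrite eq_le u0 sqn_ge0.
rewrite psumr_eq0 => [/allP/(_ i)|j _]; last exact: sqr_ge0.
by rewrite mem_index_enum -expr2 sqrf_eq0; exact.
Qed.

Lemma sqnZ a u : sqn (a *: u) = a ^+ 2 * sqn u.
Proof. by rewrite /sqn !dotpE; ring. Qed.

Lemma sqnN u : sqn (- u) = sqn u.
Proof. by rewrite -scaleN1r sqnZ sqrrN expr1n mul1r. Qed.

Lemma sqnBC u v : sqn (u - v) = sqn (v - u).
Proof. by rewrite -sqnN opprB. Qed.

Lemma sqr_enorm u : enorm u ^+ 2 = sqn u.
Proof. by rewrite sqr_sqrtr// sqn_ge0. Qed.

Lemma coord_sqr_le_sqn u i : u 0 i ^+ 2 <= sqn u.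
Proof.
rewrite /sqn /dotp (bigD1 i)//= -expr2 lerDl.
by apply: sumr_ge0 => j _; exact: sqr_ge0.
Qed.

Lemma dotp_young c u v : 0 < c -> 2 * dotp u v <= c * sqn u + c^-1 * sqn v.
Proof.
move=> c0; have c1 : c * c^-1 = 1 by rewrite divff ?gt_eqF.
have : 0 <= c^-1 * sqn (c *: u - v).
  by rewrite mulr_ge0 ?sqn_ge0// invr_ge0 ltW.
have -> : c^-1 * sqn (c *: u - v) =
    (c * c^-1) * (c * sqn u - 2 * dotp u v) + c^-1 * sqn v.
  by rewrite /sqn !dotpE (dotpC v u); ring.
by rewrite c1; lra.
Qed.

Lemma sqnD_young c u v : 0 < c ->
  sqn (u + v) <= (1 + c) * sqn u + (1 + c^-1) * sqn v.
Proof.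
move=> /(dotp_young u v); rewrite /sqn !dotpE (dotpC v u); lra.
Qed.

Lemma sqnD2 u v : sqn (u + v) <= 2 * sqn u + 2 * sqn v.
Proof. by have := sqnD_young u v ltr01; rewrite invr1. Qed.

Lemma sqnD4 u v w x :
  sqn (u + v + (w + x)) <= 4 * (sqn u + sqn v + sqn w + sqn x).
Proof.
have := sqnD2 (u + v) (w + x); have := sqnD2 u v; have := sqnD2 w x; lra.
Qed.

End DotProduct.

(** * Means and averages over the machines *)

Section Mean.
Context {R : realType} {n d : nat}.
Implicit Types (a b : 'I_n.+1 -> R) (v : 'I_n.+1 -> 'rV[R]_d).

Definition mean a : R := n.+1%:R^-1 * \sum_k a k.

Lemma mean_cst (c : R) : mean (fun=> c) = c.
Proof.
by rewrite /mean sumr_const card_ord -[c *+ _]mulr_natl mulKf// pnatr_eq0.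
Qed.

Lemma meanD a b : mean (fun k => a k + b k) = mean a + mean b.
Proof. by rewrite /mean big_split mulrDr. Qed.

Lemma meanZ c a : mean (fun k => c * a k) = c * mean a.
Proof. by rewrite /mean -mulr_sumr mulrCA. Qed.

Lemma meanN a : mean (fun k => - a k) = - mean a.
Proof. by rewrite /mean sumrN mulrN. Qed.

Lemma meanB a b : mean (fun k => a k - b k) = mean a - mean b.
Proof. by rewrite meanD meanN. Qed.

Lemma le_mean a b : (forall k, a k <= b k) -> mean a <= mean b.
Proof.
by move=> ab; rewrite ler_wpM2l ?invr_ge0 ?ler0n// ler_sum.
Qed.

Lemma mean_ge0 a : (forall k, 0 <= a k) -> 0 <= mean a.
Proof. by move=> /le_mean; rewrite mean_cst. Qed.

Lemma eq_mean a b : a =1 b -> mean a = mean b.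
Proof. by move=> /funext ->. Qed.

Lemma dotp_averagel v u : dotp (average v) u = mean (fun k => dotp (v k) u).
Proof. by rewrite dotpZl dotp_suml. Qed.

Lemma average_cst (u : 'rV[R]_d) : average (fun _ : 'I_n.+1 => u) = u.
Proof.
rewrite /average sumr_const card_ord -[u *+ _]scaler_nat scalerA mulVf ?scale1r//.
Qed.

Lemma average_lin v v' c :
  average (fun k => v k + c *: v' k) = average v + c *: average v'.
Proof.
by rewrite /average big_split /= -scaler_sumr scalerDr !scalerA (mulrC c).
Qed.

Lemma averageB v v' : average (fun k => v k - v' k) = average v - average v'.
Proof.
rewrite -scaleN1r -average_lin; congr average; apply: funext => k.
by rewrite scaleN1r.
Qed.

(** The variance identity. Dropping either nonnegative term gives the two bounds by the mean squared
    norm used in the one-step estimate. *)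
Lemma mean_sqn_dev v :
  mean (fun k => sqn (v k - average v)) = mean (fun k => sqn (v k)) - sqn (average v).
Proof.
transitivity (mean (fun k => sqn (v k) - 2 * dotp (v k) (average v) +
                             sqn (average v))).
  apply: eq_mean => k; move: (average v) => u.
  by rewrite /sqn !dotpE (dotpC u); ring.
rewrite meanD meanB meanZ -dotp_averagel mean_cst /sqn; ring.
Qed.

Lemma sqn_average_le v : sqn (average v) <= mean (fun k => sqn (v k)).
Proof.
rewrite -subr_ge0 -mean_sqn_dev; apply: mean_ge0 => k; exact: sqn_ge0.
Qed.

Lemma mean_sqn_dev_le v :
  mean (fun k => sqn (v k - average v)) <= mean (fun k => sqn (v k)).
Proof. by rewrite mean_sqn_dev gerBl sqn_ge0. Qed.

End Mean.

(* Convexity and smoothness in a form that is stable under averages and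
   expectations and does not ask [G] to be the derivative of [g]. The sharp
   quadratic constant for an [L]-Lipschitz gradient is [L / 2]; the factor 2 is
   given away, so that the mean value theorem suffices. *)
Definition smooth_convex {R : realType} {d : nat} (L : R) (g : 'rV[R]_d -> R)
    (G : 'rV[R]_d -> 'rV[R]_d) :=
  forall x y, dotp (G x) (y - x) <= g y - g x
              <= dotp (G x) (y - x) + L * sqn (y - x).

Section SmoothConvex.
Context {R : realType} {d : nat} (L : R) (L0 : 0 < L).
Variables (g : 'rV[R]_d -> R) (G : 'rV[R]_d -> 'rV[R]_d).
Hypothesis gG : smooth_convex L g G.

(** For [a = G x] the length [1 / (2 L)] minimizes the quadratic upper bound at [x]. *)
Lemma smooth_convex_descent x a :
  g (x - (2 * L)^-1 *: a) <=
  g x - (2 * L)^-1 * dotp (G x) a + (4 * L)^-1 * sqn a.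
Proof.
have /andP[_] := gG x (x - (2 * L)^-1 *: a).
rewrite addrAC subrr add0r sqnN sqnZ dotpNr dotpZr.
have -> : L * ((2 * L)^-1 ^+ 2 * sqn a) = (4 * L)^-1 * sqn a.
  by field; rewrite gt_eqF.
lra.
Qed.

(** With [a = G x - G y], the value of [g] at [x - a / (2 L)] is bounded from above by smoothness at
    [x] and from below by convexity at [y]; comparing the two bounds gives the claim. *)
Lemma smooth_convex_cocoercive x y :
  sqn (G x - G y) <= 4 * L * (g x - g y - dotp (G y) (x - y)).
Proof.
set a := G x - G y.
have aE : sqn a = dotp (G x) a - dotp (G y) a by rewrite -dotpNl -dotpDl.
have /andP[+ _] := gG y (x - (2 * L)^-1 *: a).
have := smooth_convex_descent x a.
move: a aE => a aE h1; rewrite addrAC (dotpDr (x - y)) dotpNr dotpZr => h2.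
have : (2 * L)^-1 * (dotp (G x) a - dotp (G y) a) - (4 * L)^-1 * sqn a
   <= g x - g y - dotp (G y) (x - y) by lra.
rewrite -aE; have -> : (2 * L)^-1 * sqn a - (4 * L)^-1 * sqn a = (4 * L)^-1 * sqn a.
  by field; rewrite gt_eqF.
by rewrite mulrC ler_pdivrMr ?mulr_gt0// mulrC.
Qed.

Lemma smooth_convex_lipschitz x y :
  sqn (G x - G y) <= 4 * L ^+ 2 * sqn (x - y).
Proof.
apply: (le_trans (smooth_convex_cocoercive x y)).
have -> : 4 * L ^+ 2 * sqn (x - y) = 4 * L * (L * sqn (x - y)) by ring.
rewrite ler_wpM2l ?mulr_ge0 ?(ltW L0)//.
by have /andP[_] := gG y x; lra.
Qed.

(** Otherwise a gradient step of length [1 / (2 L)] would lower [g] by at least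
    [|G x|^2 / (4 L)]. *)
Lemma smooth_convex_minimizer x : minimizer g x -> G x = 0.
Proof.
move=> /(_ (x - (2 * L)^-1 *: G x)) gx; apply: sqn_eq0.
have := le_trans gx (smooth_convex_descent x (G x)).
have -> : g x - (2 * L)^-1 * dotp (G x) (G x) + (4 * L)^-1 * sqn (G x) =
  g x - (4 * L)^-1 * sqn (G x) by rewrite /sqn; field; rewrite gt_eqF.
move=> h; rewrite -(@pmulr_rle0 _ (4 * L)^-1) ?invr_gt0 ?mulr_gt0//; lra.
Qed.

End SmoothConvex.

(** * Quadratic bounds from a Lipschitz gradient and convexity *)

Section Gradient.
Context {R : realType} {d : nat}.
Implicit Types (g : 'rV[R]_d -> R) (x y v : 'rV[R]_d).

Lemma derive_gradient g x v : differentiable g x ->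
  'D_v g x = dotp (gradient g x) v.
Proof.
move=> dg; rewrite deriveE// {1}(row_sum_delta v) linear_sum.
by apply: eq_bigr => i _; rewrite linearZ mxE deriveE// [RHS]mulrC.
Qed.

Lemma mvt_gradient g x v : (forall y, differentiable g y) ->
  exists2 t, 0 < t < 1 & g (v + x) - g x = dotp (gradient g (t *: v + x)) v.
Proof.
move=> dg; pose h (t : R) := g (t *: v + x).
have dh (t : R) : is_derive t 1 h (dotp (gradient g (t *: v + x)) v).
  have hE : (fun s : R => s^-1 *: ((h \o shift t) (s *: 1) - h t)) =
      (fun s : R => s^-1 *: ((g \o shift (t *: v + x)) (s *: v) - g (t *: v + x))).
    by apply: funext => s; rewrite /h /= [s *: 1]mulr1 scalerDl addrA.
  have : derivable g (t *: v + x) v by apply: diff_derivable.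
  rewrite -(derive_gradient v (dg (t *: v + x))) => dv; split.
  - by rewrite /derivable hE.
  - by rewrite /derive hE.
have [|t] := @MVT R h _ 0 1 ltr01 (fun t _ => dh t).
  apply: continuous_subspaceT => t.
  by apply: differentiable_continuous; apply/derivable1_diffP; case: (dh t).
rewrite in_itv /= => t01; rewrite /h scale1r scale0r add0r subr0 mulr1 => ->.
by exists t.
Qed.

(** The mean value theorem and the Lipschitz gradient give a linear approximation with quadratic
    error. The upper bound is its case [t = 1]; the lower bound follows from convexity on a short
    segment. A separate [Lk <= L] gives all machines one positive constant even if some [Lk]
    vanish. *)
Lemma convex_smooth_smooth_convex (L Lk : R) g : 0 < L -> 0 <= Lk <= L ->
  convex_smooth Lk g -> smooth_convex L g (gradient g).
Proof.
move=> L0 /andP[Lk0 LkL] [cg dg lg].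
have lip x y : sqn (gradient g x - gradient g y) <= L ^+ 2 * sqn (x - y).
  rewrite -!sqr_enorm -exprMn lerXn2r ?nnegrE ?mulr_ge0 ?sqrtr_ge0 ?(ltW L0)//.
  by apply: (le_trans (lg x y)); rewrite ler_wpM2r ?sqrtr_ge0.
have near_linear x v (t : R) : 0 < t <= 1 ->
    `|g (t *: v + x) - g x - t * dotp (gradient g x) v| <= t * (L * t * sqn v).
  move=> /andP[t0 t1].
  have [s /andP[s0 s1]] := mvt_gradient x (t *: v) dg.
  rewrite dotpZr scalerA => ->; rewrite -mulrBr normrM gtr0_norm//.
  rewrite ler_pM2l// -dotpNl -dotpDl.
  set a := _ - _.
  have {}lip : sqn a <= (L * t) ^+ 2 * sqn v.
    apply: (le_trans (lip _ _)); rewrite addrK sqnZ mulrA.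
    rewrite ler_wpM2r ?sqn_ge0// -exprMn lerXn2r ?nnegrE ?mulr_ge0 ?ltW//.
    by rewrite ltr_pM2l// gtr_pMl.
  have Lt0 : 0 < L * t by rewrite mulr_gt0.
  have {}lip : (L * t)^-1 * sqn a <= L * t * sqn v.
    by rewrite ler_pdivrMl// mulrA -expr2.
  (* Young's inequality with weight [1 / (L t)] stands in for Cauchy-Schwarz: each of its two terms
     is then at most [L t |v|^2]. *)
  have Lt1 : 0 < (L * t)^-1 by rewrite invr_gt0.
  have := dotp_young a v Lt1; have := dotp_young (- a) v Lt1.
  rewrite invrK sqnN dotpNl ler_norml; lra.
move=> x y; set v := y - x.
have gE : g y = g (v + x) by rewrite subrK.
apply/andP; split; last first.
  have := near_linear x v 1; rewrite lexx ltr01 => /(_ isT).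
  by rewrite scale1r -gE ler_norml; lra.
apply/ler_addgt0Pr => e e0.
have [v0|v0] := eqVneq (sqn v) 0.
  have := near_linear x v 1; rewrite lexx ltr01 => /(_ isT).
  by rewrite scale1r -gE ler_norml v0; lra.
have {}v0 : 0 < sqn v by rewrite lt_neqAle eq_sym v0 sqn_ge0.
(* After division by [t], the quadratic error [L t |v|^2] is at most [e]. *)
pose t := Num.min 1 (e / (L * sqn v)).
have t0 : 0 < t by rewrite lt_min ltr01 divr_gt0 ?mulr_gt0.
have t1 : t <= 1 by rewrite ge_min lexx.
have te : L * t * sqn v <= e.
  by rewrite mulrAC mulrC -ler_pdivlMr ?mulr_gt0// ge_min lexx orbT.
have := near_linear x v t; rewrite t0 t1 => /(_ isT).
rewrite ler_norml => /andP[+ _].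
have : t * (L * t * sqn v) <= t * e by rewrite ler_pM2l.
have : g (t *: y + (1 - t) *: x) <= t * g y + (1 - t) * g x.
  exact: (cg (Itv01 (ltW t0) t1) y x (in_setT _) (in_setT _)).
have -> : t *: y + (1 - t) *: x = t *: v + x.
  by rewrite scalerBl scale1r scalerBr -addrA [- _ + x]addrC.
move=> h1 h2 h3.
have : t * dotp (gradient g x) v <= t * (g y - g x + e) by lra.
by rewrite ler_pM2l.
Qed.

End Gradient.

(** * Measurability and independence *)

Section Continuity.
Context {R : realType} {d : nat}.
Implicit Types (x y : 'rV[R]_d).

(** Balls refer to the sup norm, hence the dimension factor. *)
Lemma sqn_ball x y e : ball x e y -> sqn (y - x) <= d%:R * e ^+ 2.
Proof.
move=> [_ xy]; apply: (@le_trans _ _ (\sum_(i < d) e ^+ 2)).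
  apply: ler_sum => i _; rewrite !mxE -expr2 -[(_ + _) ^+ 2]real_normK ?num_real// distrC.
  have /ltW xye : `|x 0 i - y 0 i| < e by exact: xy.
  by rewrite lerXn2r ?nnegrE// (le_trans _ xye).
by rewrite sumr_const card_ord mulr_natl.
Qed.

(** A continuity criterion shaped to fit Young's inequality, so that no square root has to be
    handled. *)
Lemma sqn_continuous (g : 'rV[R]_d -> R) :
  (forall x e, 0 < e -> exists2 C, 0 <= C &
    forall y, `|g y - g x| <= e + C * sqn (y - x)) ->
  continuous g.
Proof.
move=> hg x; apply/(@cvgrPdist_lt _ _ _ _ (nbhs_filter x)) => e e0.
have e20 : 0 < e / 2 by rewrite divr_gt0.
have [C C0 gC] := hg x _ e20.
have Cd0 : 0 < 1 + C * d%:R by rewrite ltr_pwDl// mulr_ge0.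
(* The bound by 1 gives [r^2 <= r], and the other bound makes [C d r] smaller than [e / 2]. *)
pose r := Num.min 1 (e / 2 / (1 + C * d%:R)).
have r0 : 0 < r by rewrite lt_min ltr01 divr_gt0.
apply/nbhs_ballP; exists r => //= y /sqn_ball yx.
rewrite distrC; apply: (le_lt_trans (gC y)).
rewrite [ltRHS]splitr ltrD2l; apply: (@le_lt_trans _ _ (C * d%:R * r)).
  rewrite -mulrA ler_wpM2l//; apply: (le_trans yx).
  by rewrite ler_wpM2l// expr2 ger_pMl// ge_min lexx.
apply: (@lt_le_trans _ _ ((1 + C * d%:R) * r)).
  by rewrite ltr_pM2r// ltrDr.
by rewrite -ler_pdivlMl// mulrC ge_min lexx orbT.
Qed.

Lemma smooth_convex_continuous L g (G : 'rV[R]_d -> 'rV[R]_d) :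
  0 < L -> smooth_convex L g G -> continuous g.
Proof.
move=> L0 gG; apply: sqn_continuous => x e e0.
(* With this weight the gradient half of Young's inequality costs at most [e]. *)
pose c := e / (1 + sqn (G x)).
have s0 : 0 < 1 + sqn (G x) by rewrite ltr_pwDl// sqn_ge0.
have c0 : 0 < c by rewrite divr_gt0.
have cs : c * sqn (G x) <= e.
  by rewrite /c -mulrA ger_pMr// mulrC ler_pdivrMr// mul1r lerDr.
exists (c^-1 + L); first by rewrite addr_ge0 ?invr_ge0 ?ltW.
move=> y; have /andP[h1 h2] := gG x y.
have y1 := dotp_young (G x) (y - x) c0.
have y2 := dotp_young (- G x) (y - x) c0.
rewrite sqnN dotpNl in y2.
have L1 : 0 <= L * sqn (y - x) by rewrite mulr_ge0 ?sqn_ge0 ?ltW.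
have L2 : 0 <= c^-1 * sqn (y - x) by rewrite mulr_ge0 ?sqn_ge0 ?invr_ge0 ?ltW.
rewrite ler_norml mulrDl; lra.
Qed.

Lemma smooth_convex_gradient_continuous L g (G : 'rV[R]_d -> 'rV[R]_d) i :
  0 < L -> smooth_convex L g G -> continuous (fun x => G x 0 i).
Proof.
move=> L0 gG; apply: sqn_continuous => x e e0.
exists (e^-1 * (4 * L ^+ 2)) => [|y].
  by rewrite !mulr_ge0 ?invr_ge0 ?ltW.
have := le_trans (coord_sqr_le_sqn (G y - G x) i)
  (smooth_convex_lipschitz L0 gG y x).
rewrite !mxE; set a := _ - _ => ha.
rewrite -(ler_pM2l e0) mulrDr -mulrA mulVKf ?gt_eqF//.
have := sqr_ge0 (`|a| - e); rewrite sqrrB real_normK ?num_real// -expr2.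
have : 0 <= e * `|a| by rewrite mulr_ge0 ?normr_ge0 ?(ltW e0).
rewrite -mulr_natl (mulrC `|a|); lra.
Qed.

End Continuity.

Section Measurability.
Context {R : realType} {d : nat}.

(** Stated by coordinates, so that no sigma-algebra on row vectors enters, and for any domain, so
    that it applies to sub-sigma-algebras too. *)
Definition vmeasurable {dT} {T : measurableType dT} (X : T -> 'rV[R]_d) :=
  forall i, measurable_fun setT (fun w => X w 0 i).

Let grid (N : nat) (v : 'rV[int]_d) : 'rV[R]_d :=
  \row_i (N.+1%:R^-1 * (v 0 i)%:~R).

Let cell (N : nat) (x : 'rV[R]_d) : 'rV[int]_d :=
  \row_i Num.floor (N.+1%:R * x 0 i).

Let grid_cell_cvg x : grid N (cell N x) @[N --> \oo] --> x.
Proof.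
apply/cvg_ballP => e e0.
near=> N.
suff: 0 < e /\ forall i j, ball (x i j) e (grid N (cell N x) i j) by [].
split=> // i j; rewrite [i]ord1 !mxE /ball /=.
have N0 : 0 < N.+1%:R :> R by rewrite ltr0n.
have := floor_itv (N.+1%:R * x 0 j); rewrite intrD mulr1z => /andP[f1 f2].
rewrite -[X in `|X - _|](mulKf (lt0r_neq0 N0)) -mulrBr normrM gtr0_norm ?invr_gt0//.
apply: (@le_lt_trans _ _ N.+1%:R^-1).
  rewrite ger_pMr ?invr_gt0// ler_norml; lra.
by near: N; exact: near_infty_natSinv_lt (PosNum e0).
Unshelve. all: by end_near. Qed.

(* Caratheodory functions are jointly measurable: round the first variable to
   a grid, on which the function takes countably many values. *)
Lemma measurable_caratheodory d1 d2 (T1 : measurableType d1)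
    (T2 : measurableType d2) (X : T1 -> 'rV[R]_d) (h : 'rV[R]_d -> T2 -> R) :
  vmeasurable X -> (forall x, measurable_fun setT (h x)) ->
  (forall z, continuous (h^~ z)) ->
  measurable_fun setT (fun p : T1 * T2 => h (X p.1) p.2).
Proof.
move=> mX mh ch.
apply: (@measurable_fun_cvg _ _ _ setT
  (fun N (p : T1 * T2) => h (grid N (cell N (X p.1))) p.2)); last first.
  move=> [w z] _ /=.
  exact: (cvg_comp _ _ (@grid_cell_cvg (X w)) (ch z (X w))).
move=> N _ B mB; rewrite setTI.
(* Splitting by the cell of [X w] turns the preimage into a countable union of measurable
   rectangles. *)
rewrite (_ : _ @^-1` _ = \bigcup_(v : 'rV[int]_d)
  ((\bigcap_(i : 'I_d) [set w | Num.floor (N.+1%:R * X w 0 i) = v 0 i])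
    `*` (h (grid N v) @^-1` B))); last first.
  apply/seteqP; split => [[w z] /= hB|[w z] [v _ [/= wv hB]]].
    by exists (cell N (X w)) => //=; split=> // i _; rewrite !mxE.
  rewrite (_ : cell N (X w) = v)//.
  by apply/rowP => i; rewrite mxE; exact: wv.
apply: countable_bigcupT_measurable; [exact: countableP|move=> v].
apply: measurableX; last by rewrite -[X in measurable X]setTI; exact: mh.
apply: fin_bigcap_measurable => // i _.
rewrite (_ : [set w | _] = (fun w => X w 0 i) @^-1`
  `[N.+1%:R^-1 * (v 0 i)%:~R, N.+1%:R^-1 * (v 0 i + 1)%:~R[); last first.
  apply/seteqP; split => w /=; rewrite in_itv/= ler_pdivrMl// ltr_pdivlMl//.
    by move=> <-; exact: floor_itv.
  exact: floor_def.
by rewrite -[X in measurable X]setTI; exact: mX.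
Qed.

End Measurability.

(** * Integrals of bounded functions under a probability *)

Section BoundedIntegrals.
Context {R : realType}.

Definition rbounded {T : Type} (X : T -> R) := exists M, forall w, `|X w| <= M.

Context {d} {T : measurableType d} (P : probability T R).

Lemma bounded_integrable (X : T -> R) :
  measurable_fun setT X -> rbounded X -> P.-integrable setT (EFin \o X).
Proof.
move=> mX [M XM]; apply: measurable_bounded_integrable => //.
  exact: le_lt_trans (probability_le1 P measurableT) (ltry 1).
exists M; split; first exact: num_real.
by move=> N MN w _ /=; rewrite (le_trans (XM w))// ltW.
Qed.

Lemma integrable_Rintegral_sum (I : Type) (r : seq I) (X : I -> T -> R) :
  (forall i, P.-integrable setT (EFin \o X i)) ->
  P.-integrable setT (EFin \o (fun w => \sum_(i <- r) X i w)) /\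
  \int[P]_w (\sum_(i <- r) X i w) = \sum_(i <- r) \int[P]_w X i w.
Proof.
move=> iX; elim: r => [|i r [ir rE]].
  under eq_fun do rewrite big_nil.
  rewrite big_nil; split; first exact: integrable0.
  by rewrite Rintegral_cst// mul0r.
under eq_fun do rewrite big_cons.
rewrite big_cons -rE; split; last by rewrite -RintegralD.
exact: (integrableD measurableT (iX i) ir).
Qed.

Lemma Rintegral_mean n (X : 'I_n.+1 -> T -> R) :
  (forall i, P.-integrable setT (EFin \o X i)) ->
  \int[P]_w mean (X ^~ w) = mean (fun k => \int[P]_w X k w).
Proof.
move=> /(integrable_Rintegral_sum (index_enum 'I_n.+1))[iX XE].
by rewrite RintegralZl// XE.
Qed.

Lemma Rintegral_norm_le (X : T -> R) M :
  measurable_fun setT X -> (forall w, `|X w| <= M) -> `|\int[P]_w X w| <= M.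
Proof.
move=> mX XM.
have bX : rbounded X by exists M.
have iX := bounded_integrable mX bX.
apply: (le_trans (le_normr_Rintegral measurableT iX)).
have -> : M = \int[P]_w M.
  transitivity (M * fine (P setT)); first by rewrite probability_setT mulr1.
  by rewrite Rintegral_cst.
apply: le_Rintegral => //.
  exact: integrable_norm.
exact: finite_measure_integrable_cst.
Qed.

End BoundedIntegrals.

(** * Integrating out an independent variable *)

Section Independence.
Context {R : realType} {d1 d2 : measure_display}.
Context {T1 : measurableType d1} {T2 : measurableType d2}.
Variable Q : probability T2 R.
Variable h : T1 * T2 -> R.
Hypotheses (mh : measurable_fun setT h) (bh : rbounded h).

Let mhx x : measurable_fun setT (fun z => h (x, z)).
Proof. exact: (measurableT_comp mh (pair1_measurable x)). Qed.

Let bhx x : rbounded (fun z => h (x, z)).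
Proof. by case: bh => M hM; exists M. Qed.

Let FE x : fubini_F Q (EFin \o h) x = (\int[Q]_z h (x, z))%:E.
Proof. by rewrite fineK// integrable_fin_num//; exact: bounded_integrable. Qed.

Lemma measurable_Rintegral_section :
  measurable_fun setT (fun x => \int[Q]_z h (x, z)).
Proof.
(* The product measure needs some measure on [T1]; the section integrals do not depend on it, so a
   Dirac mass will do. *)
pose m1 : probability T1 R := \d_(point : T1).
have ih : (m1 \x Q)%E.-integrable setT (EFin \o h) by exact: bounded_integrable.
apply/measurable_EFinP; apply: eq_measurable_fun (measurable_fubini_F ih) => x _.
by rewrite FE.
Qed.

Lemma rbounded_Rintegral_section : rbounded (fun x => \int[Q]_z h (x, z)).
Proof. by case: bh => M hM; exists M => w; apply: Rintegral_norm_le. Qed.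

Context {d0 : measure_display} {T : measurableType d0} (P : probability T R).
Variables (U : T -> T1) (V : T -> T2).
Hypotheses (mU : measurable_fun setT U) (mV : measurable_fun setT V).
Hypothesis UV : forall A B, measurable A -> measurable B ->
  P (U @^-1` A `&` V @^-1` B) = (P (U @^-1` A) * Q B)%E.

(** By [UV] the law of [(U, V)] agrees on rectangles with the product of the law of [U] and [Q],
    hence equals it, and Fubini applies. *)
Lemma Rintegral_independent :
  \int[P]_w h (U w, V w) = \int[P]_w (\int[Q]_z h (U w, z)).
Proof.
pose X := mfun_Sub (mem_set mU : U \in mfun).
pose W w := (U w, V w).
have mW : measurable_fun setT W by exact: measurable_fun_pair.
pose Y := mfun_Sub (mem_set mW : W \in mfun).
pose m1 : probability T1 R := distribution P X.
pose m12 : probability (T1 * T2)%type R := distribution P Y.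
have mE A : measurable A -> (m1 \x Q)%E A = m12 A.
  by apply: product_measure_unique => A1 A2 mA1 mA2; exact: UV.
have /measurable_EFinP mhE := mh.
have ih : m12.-integrable setT (EFin \o h) by exact: bounded_integrable.
have ihW : P.-integrable setT (EFin \o h \o Y).
  apply: bounded_integrable; first exact: measurableT_comp.
  by case: bh => M hM; exists M => w; exact: hM.
have ih12 : (m1 \x Q)%E.-integrable setT (EFin \o h) by exact: bounded_integrable.
rewrite /Rintegral; congr fine.
rewrite -(integral_distribution mhE ihW) (eq_measure_integral (m1 \x Q)%E).
  rewrite -integral12_prod_meas1// integral_distribution//.
    by apply: eq_integral => w _; exact: FE.
    exact: measurable_fubini_F ih12.
  rewrite (_ : _ \o _ = EFin \o (fun w => \int[Q]_z h (U w, z))).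
    apply: bounded_integrable.
      exact: (measurableT_comp measurable_Rintegral_section mU).
    by have [M hM] := rbounded_Rintegral_section; exists M => w; exact: hM.
  by apply: funext => w; exact: FE.
by move=> A mA _; exact/esym/mE.
Qed.

End Independence.

Section GeneratedIndependence.
Context {R : realType} {d : measure_display} {T : measurableType d}.
Variables (P : probability T R) (G : set (set T)).
Hypothesis Gm : G `<=` measurable.

Lemma g_sigma_sub_measurable : <<s G >> `<=` measurable.
Proof. exact: smallest_sub (@sigma_algebra_measurable _ T) Gm. Qed.

(** A sub-sigma-algebra is treated as another measurable structure on the same carrier; composing
    with the identity moves measurability to the ambient one. *)
Lemma measurable_id_g_sigma :
  measurable_fun setT (id : T -> g_sigma_algebraType G).
Proof. by move=> _ A mA; rewrite setTI; exact: g_sigma_sub_measurable. Qed.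

(** Both sides are finite measures in [A] that agree on a pi-system containing the whole space, so
    uniqueness of measures applies. *)
Lemma g_sigma_independent (C : set T) : setI_closed G -> G setT -> measurable C ->
  (forall A, G A -> P (A `&` C) = (P A * P C)%E) ->
  forall A, <<s G >> A -> P (A `&` C) = (P A * P C)%E.
Proof.
move=> GI GT mC GC.
pose r : {nonneg R} := NngNum (fine_ge0 (measure_ge0 P C)).
have rE : (r%:num)%:E = P C by rewrite fineK// fin_num_measure.
pose T' : measurableType _ := g_sigma_algebraType G.
pose f := mfun_Sub (mem_set measurable_id_g_sigma : _ \in mfun) : {mfun T >-> T'}.
pose m1 := (pushforward (mrestr P mC) f : {measure set T' -> \bar R}).
pose m2 : {measure set T' -> \bar R} := mscale r (distribution P f).
have m2E A : m2 A = (P A * P C)%E.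
  by transitivity ((r%:num)%:E * P A)%E; rewrite // rE muleC.
move=> A sA; rewrite -m2E.
apply: (@measure_unique _ _ T' G (fun=> setT) erefl GI (fun=> GT) _
  (m1 measurable_id_g_sigma) m2) => //.
- exact: bigcup_const.
- by move=> B GB; rewrite m2E -GC.
- move=> _.
  exact: le_lt_trans (probability_le1 P (measurableI _ _ measurableT mC)) (ltry 1).
Qed.

End GeneratedIndependence.

(** * The filtration of past sources and the independence of a fresh sample *)

Section Past.
Context {R : realType} {n d : nat} {dX dO : measure_display}.
Context {Xi : 'I_n.+1 -> measurableType dX} {Omega : measurableType dO}.
Variables (S m : nat) (P : probability Omega R).
Variables (D : forall k, probability (Xi k) R) (x0 : Omega -> 'rV[R]_d).
Variable xi : forall k, nat -> nat -> Omega -> Xi k.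
Hypothesis hs : independent_sampling P D S m x0 xi.

Let index := option ('I_n.+1 * 'I_S * 'I_m).
Let source : index -> set (set Omega) := source_events x0 xi.

Let mx0 : measurable_fun setT (x0 : Omega -> borel_rV R d).
Proof. by case: hs. Qed.

Lemma measurable_sample k s t : (s < S)%N -> (t < m)%N ->
  measurable_fun setT (xi k s t).
Proof. by move=> sS tm; case: hs => _ + _ _; apply. Qed.

Let source_measurable i A : source i A -> measurable A.
Proof.
case: i => [[[k s] t]|] [B mB <-]; last exact: mx0.
exact: measurable_sample.
Qed.

Let sourceT i : source i setT.
Proof. by case: i => [[[k s] t]|]; exists setT; rewrite ?setTI. Qed.

Let sourceI i : setI_closed (source i).
Proof.
case: i => [[[k s] t]|] _ _ [A mA <-] [B mB <-].
- by exists (A `&` B); [exact: measurableI|rewrite !setTI].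
- by exists (A `&` B); [exact: measurableI|rewrite !setTI].
Qed.

(** Samples drawn at the same step by other machines are excluded. This suffices because the
    sample-dependent part of the one-step bound is a mean of terms involving one machine each. *)
Definition before s t (i : index) : bool :=
  if i is Some (_, s', t') then (s' < s)%N || (s' == s :> nat) && (t' < t)%N
  else true.

(* The pi-system of events that depend on finitely many of the sources
   preceding step [t] of stage [s]. *)
Definition past s t : set (set Omega) := [set A | exists F,
  [/\ forall i, source i (F i), forall i, ~~ before s t i -> F i = setT
    & A = \bigcap_(i in [set: index]) F i]].

Lemma past_setI_closed s t : setI_closed (past s t).
Proof.
move=> _ _ [F [sF bF ->]] [F' [sF' bF' ->]].
exists (fun i => F i `&` F' i); split => [i|i bi|].
- exact: sourceI.
- by rewrite bF// bF'// setIT.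
- by rewrite bigcapI.
Qed.

Lemma past_setT s t : past s t setT.
Proof. by exists (fun=> setT); split => //; rewrite bigcap_const//; exists None. Qed.

Lemma past_measurable s t : past s t `<=` measurable.
Proof.
move=> _ [F [sF _ ->]]; apply: fin_bigcap_measurable => [|i _].
  exact: finite_finset.
exact: source_measurable.
Qed.

Lemma sub_past s t s' t' :
  (forall i, before s t i -> before s' t' i) -> past s t `<=` past s' t'.
Proof.
move=> bb A [F [sF bF ->]]; exists F; split => // i bi; apply: bF.
by apply: contra bi; exact: bb.
Qed.

Lemma source_past s t i : before s t i -> source i `<=` past s t.
Proof.
move=> bi A sA; exists (fun j => if j == i then A else setT); split=> [j|j|].
- by case: eqP => [->|].
- by case: eqP => // ->; rewrite bi.
- apply/seteqP; split => [w Aw j _|w /(_ i Logic.I)]; last by rewrite eqxx.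
  by case: eqP.
Qed.

(** A generator of the past leaves the slot of the fresh sample equal to the whole space. Filling
    that slot with the new event and applying mutual independence twice gives the product formula,
    which then extends to the generated sigma-algebra. *)
Lemma past_independent k s t A B : (s < S)%N -> (t < m)%N ->
  <<s past s t >> A -> measurable B ->
  P (A `&` xi k s t @^-1` B) = (P A * D k B)%E.
Proof.
move=> sS tm pA mB; pose C := xi k s t @^-1` B.
pose i0 : index := Some (k, Ordinal sS, Ordinal tm).
have sC : source i0 C by exists B; rewrite // setTI.
have <- : P C = D k B by case: hs => _ _ /(_ k s t sS tm B mB) ->.
apply: (g_sigma_independent (@past_measurable s t)) pA.
- exact: past_setI_closed.
- exact: past_setT.
- exact: source_measurable sC.
move=> _ [F [sF bF ->]].
have Fi0 : F i0 = setT by apply: bF; rewrite /= ltnn eqxx ltnn.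
have PE F' : (forall i, source i (F' i)) ->
    P (\bigcap_(i in [set: index]) F' i) = (\prod_i P (F' i))%E.
  move=> sF'; case: hs => _ _ _ /(_ [set: index]%SET F' (fun i _ => sF' i)).
  rewrite (_ : [set` [set: index]%SET] = setT); last first.
    by apply/seteqP; split => // i _ /=; rewrite inE.
  by move=> ->; apply: eq_bigl => i; rewrite inE.
pose F' i := if i == i0 then C else F i.
have -> : \bigcap_(i in [set: index]) F i `&` C = \bigcap_(i in [set: index]) F' i.
  apply/seteqP; split => [w [Fw Cw] i _|w F'w].
    by rewrite /F'; case: eqP => // _; exact: Fw.
  split; last by have := F'w i0 Logic.I; rewrite /F' eqxx.
  move=> i _; have := F'w i Logic.I; rewrite /F'; case: eqP => // -> _.
  by rewrite Fi0.
rewrite !PE//; last by move=> i; rewrite /F'; case: eqP => // ->.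
rewrite (bigD1 i0)//= [in RHS](bigD1 i0)//= Fi0 probability_setT mul1e muleC.
rewrite /F' eqxx; congr (_ * _)%E; apply: eq_bigr => i /negbTE -> //.
Qed.

End Past.

Section VectorMeasurability.
Context {R : realType} {d : nat} {dT : measure_display} {T : measurableType dT}.
Implicit Types (X Y : T -> 'rV[R]_d) (x : 'rV[R]_d).

Lemma vmeasurable_cst x : vmeasurable (fun _ : T => x).
Proof. by move=> i; exact: measurable_cst. Qed.

Lemma vmeasurableD X Y : vmeasurable X -> vmeasurable Y ->
  vmeasurable (fun w => X w + Y w).
Proof.
move=> mX mY i; under eq_fun do rewrite mxE; exact: measurable_funD.
Qed.

Lemma vmeasurableZ c X : vmeasurable X -> vmeasurable (fun w => c *: X w).
Proof.
move=> mX i; under eq_fun do rewrite mxE.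
exact: (measurable_funM (measurable_cst c) (mX i)).
Qed.

Lemma vmeasurableB X Y : vmeasurable X -> vmeasurable Y ->
  vmeasurable (fun w => X w - Y w).
Proof.
move=> mX /(vmeasurableZ (-1)) mY; under eq_fun do rewrite -scaleN1r.
exact: vmeasurableD.
Qed.

Lemma vmeasurable_sum (I : Type) (r : seq I) (X : I -> T -> 'rV[R]_d) :
  (forall i, vmeasurable (X i)) -> vmeasurable (fun w => \sum_(i <- r) X i w).
Proof.
move=> mX j; under eq_fun do rewrite summxE.
by apply: measurable_sum => i; exact: mX.
Qed.

Lemma vmeasurable_average n (X : 'I_n.+1 -> T -> 'rV[R]_d) :
  (forall k, vmeasurable (X k)) -> vmeasurable (fun w => average (X ^~ w)).
Proof. by move=> mX; apply: vmeasurableZ; exact: vmeasurable_sum. Qed.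

Lemma measurable_dotp X Y : vmeasurable X -> vmeasurable Y ->
  measurable_fun setT (fun w => dotp (X w) (Y w)).
Proof.
move=> mX mY; apply: measurable_sum => i; exact: measurable_funM.
Qed.

Lemma measurable_sqn X : vmeasurable X -> measurable_fun setT (fun w => sqn (X w)).
Proof. by move=> mX; exact: measurable_dotp. Qed.

Lemma measurable_mean n (X : 'I_n.+1 -> T -> R) :
  (forall k, measurable_fun setT (X k)) ->
  measurable_fun setT (fun w => mean (X ^~ w)).
Proof.
by move=> mX; apply: measurable_funM => //; exact: measurable_sum.
Qed.

Lemma vmeasurable_comp d' (T' : measurableType d') (U : T' -> T) X :
  measurable_fun setT U -> vmeasurable X -> vmeasurable (X \o U).
Proof. by move=> mU mX i; exact: measurableT_comp (mX i) mU. Qed.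

Lemma measurable_continuous_comp (g : 'rV[R]_d -> R) X :
  continuous g -> vmeasurable X -> measurable_fun setT (g \o X).
Proof.
move=> cg mX.
(* A continuous function is a Caratheodory function that is constant in its second variable; the
   claim is then read off on a section. *)
have mh : measurable_fun setT (fun p : T * T => g (X p.1)).
  by apply: (measurable_caratheodory (h := fun x _ => g x)).
exact: (measurableT_comp mh (pair2_measurable point)).
Qed.

End VectorMeasurability.

Section Boundedness.
Context {R : realType} {d : nat} {T : Type}.
Implicit Types (X Y : T -> 'rV[R]_d) (x : 'rV[R]_d) (f g : T -> R).

Definition vbounded {T' : Type} (X : T' -> 'rV[R]_d) := exists M, forall w, sqn (X w) <= M.

Lemma rbounded_cst c : rbounded (fun _ : T => c : R).
Proof. by exists `|c|. Qed.

Lemma rboundedD f g : rbounded f -> rbounded g -> rbounded (fun w => f w + g w).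
Proof.
move=> [M fM] [N gN]; exists (M + N) => w.
by rewrite (le_trans (ler_normD _ _))// lerD.
Qed.

Lemma rboundedZ c f : rbounded f -> rbounded (fun w => c * f w).
Proof.
by move=> [M fM]; exists (`|c| * M) => w; rewrite normrM ler_wpM2l.
Qed.

Lemma rbounded_sum (I : Type) (r : seq I) (f : I -> T -> R) :
  (forall i, rbounded (f i)) -> rbounded (fun w => \sum_(i <- r) f i w).
Proof.
move=> bf; elim: r => [|i r IH].
  by under eq_fun do rewrite big_nil; exact: rbounded_cst.
by under eq_fun do rewrite big_cons; exact: rboundedD.
Qed.

Lemma rbounded_mean n (f : 'I_n.+1 -> T -> R) :
  (forall k, rbounded (f k)) -> rbounded (fun w => mean (f ^~ w)).
Proof. by move=> bf; apply: rboundedZ; exact: rbounded_sum. Qed.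

Lemma vbounded_cst x : vbounded (fun _ : T => x).
Proof. by exists (sqn x). Qed.

Lemma vboundedD X Y : vbounded X -> vbounded Y -> vbounded (fun w => X w + Y w).
Proof.
move=> [M XM] [N YN]; exists (2 * M + 2 * N) => w.
by rewrite (le_trans (sqnD2 _ _))// lerD// ler_wpM2l.
Qed.

Lemma vboundedZ c X : vbounded X -> vbounded (fun w => c *: X w).
Proof.
move=> [M XM]; exists (c ^+ 2 * M) => w.
by rewrite sqnZ ler_wpM2l// sqr_ge0.
Qed.

Lemma vboundedB X Y : vbounded X -> vbounded Y -> vbounded (fun w => X w - Y w).
Proof.
move=> bX /(vboundedZ (-1)) bY; under eq_fun do rewrite -scaleN1r.
exact: vboundedD.
Qed.

Lemma vbounded_sum (I : Type) (r : seq I) (X : I -> T -> 'rV[R]_d) :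
  (forall i, vbounded (X i)) -> vbounded (fun w => \sum_(i <- r) X i w).
Proof.
move=> bX; elim: r => [|i r IH].
  by under eq_fun do rewrite big_nil; exact: vbounded_cst.
by under eq_fun do rewrite big_cons; exact: vboundedD.
Qed.

Lemma vbounded_average n (X : 'I_n.+1 -> T -> 'rV[R]_d) :
  (forall k, vbounded (X k)) -> vbounded (fun w => average (X ^~ w)).
Proof. by move=> bX; apply: vboundedZ; exact: vbounded_sum. Qed.

Lemma rbounded_dotp X Y : vbounded X -> vbounded Y ->
  rbounded (fun w => dotp (X w) (Y w)).
Proof.
move=> [M XM] [N YN]; exists (M + N) => w.
have := dotp_young (X w) (Y w) ltr01; have := dotp_young (- X w) (Y w) ltr01.
rewrite invr1 sqnN dotpNl; have := XM w; have := YN w.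
have := sqn_ge0 (X w); have := sqn_ge0 (Y w); rewrite ler_norml; lra.
Qed.

Lemma rbounded_sqn X : vbounded X -> rbounded (fun w => sqn (X w)).
Proof. by move=> bX; exact: rbounded_dotp. Qed.

Lemma rbounded_ge0_le f g : (forall w, 0 <= f w <= g w) -> rbounded g -> rbounded f.
Proof.
move=> fg [M gM]; exists M => w; have /andP[f0 fgw] := fg w.
by rewrite ger0_norm// (le_trans fgw)// (le_trans _ (gM w))// ler_norm.
Qed.

Lemma vbounded_comp (T' : Type) (U : T' -> T) X : vbounded X -> vbounded (X \o U).
Proof. by move=> [M XM]; exists M => w; exact: XM. Qed.

End Boundedness.

(** * Local objectives as expectations of sample losses *)

Section LocalObjectives.
Context {R : realType} {n d : nat} {dX : measure_display}.
Context {Xi : 'I_n.+1 -> measurableType dX}.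
Variable D : forall k, probability (Xi k) R.
Variable f : forall k, 'rV[R]_d -> Xi k -> R.
Arguments f {k}.
Variables (L : R).
Hypothesis L0 : 0 < L.
Hypothesis fG : forall k (z : Xi k),
  smooth_convex L (fun x => f x z) (fun x => sample_gradient (@f) x z).
Hypothesis oracle : forall k, stochastic_oracle D (@f) k.

Local Notation sgrad := (sample_gradient (@f)).
Local Notation fk := (local_objective D (@f)).

Definition local_gradient k (x : 'rV[R]_d) : 'rV[R]_d := gradient (fk k) x.

Let integrable_f k x : (D k).-integrable setT (EFin \o f x).
Proof. by case: (oracle k x). Qed.

Let integrable_grad k x i :
  (D k).-integrable setT (EFin \o (fun z => sgrad x z 0 i)).
Proof. by case: (oracle k x) => _ + _; apply. Qed.

Lemma vmeasurable_sample_gradient k x : vmeasurable (fun z : Xi k => sgrad x z).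
Proof. by move=> i; apply/measurable_EFinP; case/integrableP: (@integrable_grad k x i). Qed.

Lemma integrable_dotp_sample_gradient k x u :
  (D k).-integrable setT (EFin \o (fun z => dotp (sgrad x z) u)) /\
  \int[D k]_z dotp (sgrad x z) u = dotp (local_gradient k x) u.
Proof.
have iu i : (D k).-integrable setT (EFin \o (fun z => sgrad x z 0 i * u 0 i)).
  have := integrableZr measurableT (u 0 i) (@integrable_grad k x i).
  by [].
have [? ->] := integrable_Rintegral_sum (index_enum 'I_d) iu; split => //.
apply: eq_bigr => i _; rewrite RintegralZr//; congr (_ * _).
by rewrite /local_gradient; case: (oracle k x) => _ _ ->; rewrite mxE.
Qed.

(** Both inequalities are linear in the function and its gradient, so they pass from samples to
    expectations; the oracle identifies the expected gradient. *)
Lemma local_objective_smooth_convex k :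
  smooth_convex L (fk k) (local_gradient k).
Proof.
move=> x y; have [iG GE] := integrable_dotp_sample_gradient k x (y - x).
have iB := integrableB measurableT (@integrable_f k y) (@integrable_f k x).
rewrite -GE -RintegralB//; apply/andP; split.
  by apply: le_Rintegral => // z _; case/andP: (fG z x y).
have ic : (D k).-integrable setT (EFin \o (fun=> L * sqn (y - x))).
  exact: finite_measure_integrable_cst.
have -> : L * sqn (y - x) = \int[D k]_z (L * sqn (y - x)).
  transitivity (L * sqn (y - x) * fine (D k setT)); last by rewrite Rintegral_cst.
  by rewrite probability_setT mulr1.
rewrite -RintegralD//; apply: le_Rintegral => //.
  exact: (integrableD measurableT iG ic).
by move=> z _; case/andP: (fG z x y).
Qed.

Lemma vmeasurable_sample_gradient_comp k d1 (T : measurableType d1)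
    (X : T -> 'rV[R]_d) : vmeasurable X ->
  vmeasurable (fun p : T * Xi k => sgrad (X p.1) p.2).
Proof.
move=> mX i; apply: (measurable_caratheodory (h := fun x z => sgrad x z 0 i)) => //.
  by move=> x; exact: vmeasurable_sample_gradient.
by move=> z; exact: smooth_convex_gradient_continuous L0 (fG z).
Qed.

(** One sampled gradient may be unbounded in the sample, but the Lipschitz property bounds
    differences uniformly, and only differences occur in the algorithm. *)
Lemma vbounded_sample_gradientB k (T : Type) (X Y : T -> 'rV[R]_d) :
  vbounded X -> vbounded Y ->
  vbounded (fun p : T * Xi k => sgrad (X p.1) p.2 - sgrad (Y p.1) p.2).
Proof.
move=> bX bY; have [M XY] := vboundedB bX bY; exists (4 * L ^+ 2 * M) => p.
apply: (le_trans (smooth_convex_lipschitz L0 (fG p.2) _ _)).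
by rewrite ler_wpM2l// mulr_ge0// sqr_ge0.
Qed.

(** The Bregman divergence of the local objective. *)
Definition breg k x y := fk k x - fk k y - dotp (local_gradient k y) (x - y).

(** Samplewise co-coercivity, integrated: the expected Bregman divergence of the samples is that of
    the local objective. It controls the noise without any variance assumption. *)
Lemma sqn_sample_gradient_le k x y :
  (D k).-integrable setT (EFin \o (fun z => sqn (sgrad x z - sgrad y z))) /\
  \int[D k]_z sqn (sgrad x z - sgrad y z) <= 4 * L * breg k x y.
Proof.
have ix : (D k).-integrable setT (EFin \o (fun z => sqn (sgrad x z - sgrad y z))).
  apply: bounded_integrable.
    by apply: measurable_sqn; apply: vmeasurableB; exact: vmeasurable_sample_gradient.
  apply: rbounded_sqn; exists (4 * L ^+ 2 * sqn (x - y)) => z.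
  by have := smooth_convex_lipschitz L0 (fG z) x y.
split => //.
have [iG GE] := integrable_dotp_sample_gradient k y (x - y).
have iB := integrableB measurableT (@integrable_f k x) (@integrable_f k y).
have iBG := integrableB measurableT iB iG.
rewrite /breg -GE -RintegralB// -RintegralB// -RintegralZl//.
apply: le_Rintegral => //; first exact: (integrableZl measurableT _ iBG).
by move=> z _; have := smooth_convex_cocoercive L0 (fG z) x y.
Qed.

End LocalObjectives.

(** * One step of the potential *)

Section OneStep.
Context {R : realType} {n d : nat}.
Variables (L mu eta E a : R) (xs : 'rV[R]_d).
Hypotheses (L0 : 0 < L) (mu0 : 0 <= mu) (muL : mu <= 2 * L) (eta0 : 0 < eta).
Hypotheses (E1 : 1 <= E) (etaLE : 1000 * (eta * L * E) <= 1).
Hypotheses (a0 : 0 <= a) (aE : a + 1 <= 2 * E).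

(* The weight of the drift term decreases linearly along the local steps: after
   [j] of them it is taken at [b = 2 E - j]. *)
Definition drift_weight (b : R) : R := 16 * eta * L * b.

Definition lyapunov (b : R) (x : 'I_n.+1 -> 'rV[R]_d) : R :=
  sqn (average x - xs) + drift_weight b * mean (fun k => sqn (x k - average x)).

(** The coefficient of the squared gradients: 4 comes from splitting a gradient into four terms,
    [eta ^+ 2] from the move of the average, and the [5 * E] term from the growth of the drift. *)
Definition noise_weight : R :=
  4 * (eta ^+ 2 * (1 + 5 * E * drift_weight a)).

Let lam0 : 0 <= drift_weight a.
Proof. by rewrite !mulr_ge0// ltW. Qed.

Let E0 : 0 < E. Proof. exact: lt_le_trans E1. Qed.

Let K0 : 0 <= noise_weight.
Proof.
rewrite /noise_weight mulr_ge0// mulr_ge0 ?sqr_ge0// addr_ge0//.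
by rewrite !mulr_ge0// ltW.
Qed.

(** Applied with fixed samples, [phi k] being the sampled loss. The bound is arranged so that
    samples enter only through the last mean, in terms that co-coercivity can handle after taking
    expectations. *)
Lemma lyapunov_step_pathwise (phi : 'I_n.+1 -> 'rV[R]_d -> R)
    (Gam : 'I_n.+1 -> 'rV[R]_d -> 'rV[R]_d) (x : 'I_n.+1 -> 'rV[R]_d) xt h :
  (forall k, smooth_convex L (phi k) (Gam k)) ->
  let g k := Gam k (x k) - Gam k xt + h in
  let x' k := x k - eta *: g k in
  let xb := average x in
  let V := mean (fun k => sqn (x k - xb)) in
  is_true (lyapunov a x' <=
    sqn (xb - xs) + drift_weight a * (1 + (4 * E)^-1) * V +
      noise_weight * (4 * L ^+ 2 * V + sqn h) +
    mean (fun k => - (2 * eta) * dotp (g k) (xb - xs) +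
      noise_weight * (sqn (Gam k xb - Gam k xs) + sqn (Gam k xt - Gam k xs)))).
Proof.
move=> sG g x' xb V.
have sg k : sqn (g k) <= 4 * (4 * L ^+ 2 * sqn (x k - xb) +
    sqn (Gam k xb - Gam k xs) + sqn (Gam k xt - Gam k xs) + sqn h).
  have -> : g k = Gam k (x k) - Gam k xb + (Gam k xb - Gam k xs) +
                  (Gam k xs - Gam k xt + h).
    by rewrite /g [in RHS]subrKA [in RHS]addrA subrKA.
  apply: (le_trans (sqnD4 _ _ _ _)).
  have := smooth_convex_lipschitz L0 (sG k) (x k) xb.
  by rewrite (sqnBC (Gam k xs)); lra.
have msg : mean (fun k => sqn (g k)) <= 4 * (4 * L ^+ 2 * V +
    mean (fun k => sqn (Gam k xb - Gam k xs) + sqn (Gam k xt - Gam k xs)) + sqn h).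
  apply: (le_trans (le_mean sg)).
  rewrite meanZ !meanD meanZ mean_cst -/V; lra.
have x'E : average x' = xb - eta *: average g.
  rewrite -scaleNr -average_lin; congr average; apply: funext => k.
  by rewrite scaleNr.
have AE : sqn (average x' - xs) = sqn (xb - xs) -
    2 * eta * mean (fun k => dotp (g k) (xb - xs)) + eta ^+ 2 * sqn (average g).
  rewrite x'E -dotp_averagel addrAC; move: (xb - xs) (average g) => u v.
  by rewrite /sqn !dotpE (dotpC v); ring.
(* Young's parameter [1 / (4 E)] keeps the growth small enough for the decreasing weight to absorb;
   the other factor [1 + 4 E] is at most [5 E]. *)
have VE : mean (fun k => sqn (x' k - average x')) <=
    (1 + (4 * E)^-1) * V + 5 * E * (eta ^+ 2 * mean (fun k => sqn (g k))).
  have c0 : 0 < (4 * E)^-1 by rewrite invr_gt0 mulr_gt0.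
  have h1 k : sqn (x' k - average x') <= (1 + (4 * E)^-1) * sqn (x k - xb) +
      5 * E * (eta ^+ 2 * sqn (g k - average g)).
    have -> : x' k - average x' = (x k - xb) + (- eta) *: (g k - average g).
      rewrite x'E /x' scaleNr scalerBr !opprB [LHS]addrACA [RHS]addrACA.
      by congr (_ + _); exact: addrC.
    apply: (le_trans (sqnD_young _ _ c0)); rewrite lerD2l invrK sqnZ sqrrN.
    rewrite ler_wpM2r ?mulr_ge0 ?sqn_ge0 ?(ltW eta0)//; have := E1; lra.
  apply: (le_trans (le_mean h1)); rewrite meanD !meanZ lerD2l ler_wpM2l//.
    by rewrite mulr_ge0// ltW.
  by rewrite ler_wpM2l ?sqr_ge0 ?mean_sqn_dev_le.
rewrite /lyapunov AE meanD !meanZ.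
have h1 : eta ^+ 2 * sqn (average g) <= eta ^+ 2 * mean (fun k => sqn (g k)).
  by rewrite ler_wpM2l ?sqr_ge0 ?sqn_average_le.
have h2 := ler_wpM2l lam0 VE.
have e2 : 0 <= eta ^+ 2 * (1 + 5 * E * drift_weight a).
  by rewrite mulr_ge0 ?sqr_ge0// addr_ge0// !mulr_ge0// ltW.
have := ler_wpM2l e2 msg.
rewrite /noise_weight.
lra.
Qed.

(** The deterministic half of the step, applied to the local objectives once the samples are
    integrated out. *)
Lemma lyapunov_step_mean (phi : 'I_n.+1 -> 'rV[R]_d -> R)
    (Gam : 'I_n.+1 -> 'rV[R]_d -> 'rV[R]_d) (x : 'I_n.+1 -> 'rV[R]_d) xt :
  (forall k, smooth_convex L (phi k) (Gam k)) ->
  (forall k y z, dotp (Gam k y) (z - y) + mu / 2 * sqn (y - z) <=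
                 phi k z - phi k y) ->
  average (fun k => Gam k xs) = 0 ->
  let h := average (fun k => Gam k xt) in
  let xb := average x in
  let V := mean (fun k => sqn (x k - xb)) in
  let gap y := mean (fun k => phi k y) - mean (fun k => phi k xs) in
  let breg k y := phi k y - phi k xs - dotp (Gam k xs) (y - xs) in
  is_true (sqn (xb - xs) + drift_weight a * (1 + (4 * E)^-1) * V +
      noise_weight * (4 * L ^+ 2 * V + sqn h) +
    mean (fun k => - (2 * eta) * dotp (Gam k (x k) - Gam k xt + h) (xb - xs) +
      noise_weight * (4 * L * breg k xb + 4 * L * breg k xt)) <=
    (1 - mu * eta) * lyapunov (a + 1) x - 3 / 2 * eta * gap xb
      + 1 / 2 * eta * gap xt).
Proof.
move=> sG scG Gxs h xb V gap breg.
have mbreg y : mean (breg ^~ y) = gap y.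
  by rewrite /breg !meanB -dotp_averagel Gxs dotp0l subr0.
have mgrad : smooth_convex L (fun y => mean (fun k => phi k y))
    (fun y => average (fun k => Gam k y)).
  move=> y z; rewrite dotp_averagel -meanB.
  rewrite -[L * _](@mean_cst _ n) -meanD.
  by apply/andP; split; apply: le_mean => k; case/andP: (sG k y z).
have hle : sqn h <= 4 * L * gap xt.
  have := smooth_convex_cocoercive L0 mgrad xt xs.
  by rewrite Gxs dotp0l !subr0.
(* The variance-reduction corrections [h - Gam k xt] cancel on average. *)
have dE : mean (fun k => dotp (Gam k (x k) - Gam k xt + h) (xb - xs)) =
    mean (fun k => dotp (Gam k (x k)) (xb - xs)).
  rewrite -!dotp_averagel; congr dotp.
  transitivity (average (fun k => Gam k (x k) - Gam k xt) + h).
    rewrite -[h in RHS]scale1r -(average_cst (n := n) h) -average_lin.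
    by congr average; apply: funext => k; rewrite average_cst scale1r.
  by rewrite averageB subrK.
(* At each [x k], smoothness is used towards [xb] and strong convexity towards [xs]; Jensen then
   replaces the mean of [|x k - xs|^2]. *)
have dle : gap xb - L * V + mu / 2 * sqn (xb - xs) <=
    mean (fun k => dotp (Gam k (x k)) (xb - xs)).
  have : mean (fun k => phi k xb - phi k xs - L * sqn (x k - xb) +
      mu / 2 * sqn (x k - xs)) <= mean (fun k => dotp (Gam k (x k)) (xb - xs)).
    apply: le_mean => k; have /andP[_] := sG k (x k) xb.
    have := scG k (x k) xs; rewrite (sqnBC xb).
    have -> : xb - xs = (xb - x k) - (xs - x k).
      by rewrite opprB addrA subrK.
    rewrite dotpDr dotpNr; lra.
  apply: le_trans; rewrite !meanD !meanN !meanZ -/V lerD2l.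
  rewrite ler_wpM2l ?divr_ge0//.
  have -> : xb - xs = average (fun k => x k - xs) by rewrite averageB average_cst.
  exact: sqn_average_le.
have V0 : 0 <= V by apply: mean_ge0 => k; exact: sqn_ge0.
have gap0 y : 0 <= gap y.
  by have /andP[+ _] := mgrad xs y; rewrite Gxs dotp0l.
rewrite meanD !meanZ meanD !meanZ dE !mbreg.
have ce0 : 0 <= eta * L by rewrite mulr_ge0// ltW.
have ce : eta * L <= eta * L * E by rewrite ler_peMr.
have c0 : 0 <= eta * L * E by rewrite mulr_ge0// ltW.
(* This yields the final constants: [8 K L <= eta / 2] is the cost at [xt], and at [xb] at most
   [eta / 4] is taken from the gain [2 eta]. *)
have KL : 16 * (noise_weight * L) <= eta.
  have p1 : 5 * E * drift_weight a <= 160 * (eta * L * E) * E.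
    have a2E : a <= 2 * E by have := aE; lra.
    have := ler_wpM2l c0 a2E; rewrite /drift_weight; lra.
  have p2 : (eta * L * E) * (1000 * (eta * L * E)) <= eta * L * E.
    by rewrite ler_piMr.
  have p3 := ler_wpM2l ce0 p1.
  have p4 : 64 * (eta * L * (1 + 5 * E * drift_weight a)) <= 1.
    have := etaLE; lra.
  have := ler_wpM2l (ltW eta0) p4; rewrite /noise_weight; lra.
pose W := eta * L * V.
have W0 : 0 <= W by rewrite mulr_ge0.
(* Lowering the weight from [a + 1] to [a] frees [16 W]. Drift growth takes at most [8 W] of it, the
   inner product [2 W], and the noise and the factor [1 - mu eta] less than [W]. *)
have f1 : a * (4 * E)^-1 * W <= 1 / 2 * W.
  rewrite ler_wpM2r// ler_pdivrMr ?mulr_gt0//; have := aE; lra.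
have f2 : 16 * (noise_weight * L) * (L * V) <= W.
  by rewrite /W -[eta * L * V]mulrA ler_wpM2r// mulr_ge0// ltW.
have f3 : mu * eta * (a + 1) * W <= 4 * (eta * L * E) * W.
  rewrite ler_wpM2r//.
  have a10 : 0 <= a + 1 by rewrite addr_ge0.
  have := ler_wpM2l (ltW eta0) (ler_pM mu0 a10 muL aE); lra.
have f4 : 4 * (eta * L * E) * W <= 1 / 250 * W.
  by rewrite ler_wpM2r//; have := etaLE; lra.
have f5 := ler_wpM2l K0 hle.
have f6 := ler_wpM2r (gap0 xb) KL.
have f7 := ler_wpM2r (gap0 xt) KL.
have f8 := ler_wpM2l (ltW eta0) dle.
have f9 : 0 <= eta * gap xb by rewrite mulr_ge0// ltW.
rewrite /lyapunov -/xb -/V /drift_weight /W in W0 f1 f2 f3 f4 *.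
lra.
Qed.

End OneStep.

(** * Adaptedness of the iterates *)

Section Iterates.
Context {R : realType} {n d : nat} {dX dO : measure_display}.
Context {Xi : 'I_n.+1 -> measurableType dX} {Omega : measurableType dO}.
Variables (P : probability Omega R) (D : forall k, probability (Xi k) R).
Variable f : forall k, 'rV[R]_d -> Xi k -> R.
Variables (L mu eta : R) (S m : nat) (I : pred nat).
Variables (x0 : Omega -> 'rV[R]_d) (xi : forall k, nat -> nat -> Omega -> Xi k).
Hypothesis L0 : 0 < L.
Hypothesis fG : forall k (z : Xi k),
  smooth_convex L (fun x => f x z) (fun x => sample_gradient f x z).
Hypothesis oracle : forall k, stochastic_oracle D f k.
Hypothesis hs : independent_sampling P D S m x0 xi.

Local Notation sgrad := (sample_gradient f).
Local Notation lgrad := (local_gradient D f).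
Local Notation local_smooth := (local_objective_smooth_convex fG oracle).

Definition global_gradient x := average (fun k => lgrad k x).

(** The filtration consists of measurable structures on the same carrier, so adaptedness is an
    instance of [vmeasurable]. *)
Definition pastT s t := g_sigma_algebraType (past S m x0 xi s t).

Definition adapted s t (X : Omega -> 'rV[R]_d) :=
  @vmeasurable R d _ (pastT s t) X.

Lemma measurable_pastT s t :
  measurable_fun setT (id : Omega -> pastT s t).
Proof. by apply: measurable_id_g_sigma; exact: past_measurable hs s t. Qed.

Lemma adapted_vmeasurable s t X : adapted s t X -> vmeasurable X.
Proof. move=> aX.
exact: (@vmeasurable_comp R d _ (pastT s t) _ Omega id X (@measurable_pastT s t) aX). Qed.

Lemma measurable_pastT_le s t s' t' : (s < s')%N || (s == s') && (t <= t')%N ->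
  measurable_fun setT (id : pastT s' t' -> pastT s t).
Proof.
move=> st _ A mA; rewrite setTI.
apply: (sub_smallest2r _ _ mA); first exact: smallest_sigma_algebra.
apply: sub_past => -[[[k u] v]|//] /=.
move: st => /orP[ss'|/andP[/eqP -> tt']].
  move=> /orP[us|/andP[/eqP -> _]]; last by rewrite ss'.
  by rewrite (ltn_trans us ss').
by move=> /orP[->//|/andP[-> vt]]; rewrite (leq_trans vt tt') orbT.
Qed.

Lemma adapted_le s t s' t' X : (s < s')%N || (s == s') && (t <= t')%N ->
  adapted s t X -> adapted s' t' X.
Proof.
move=> st aX.
exact: (@vmeasurable_comp R d _ (pastT s t) _ (pastT s' t') id X
  (measurable_pastT_le st) aX).
Qed.

Lemma measurable_sample_past k s t : (s < S)%N -> (t < m)%N ->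
  measurable_fun setT (xi k s t : pastT s t.+1 -> Xi k).
Proof.
move=> sS tm _ B mB; apply: sub_sigma_algebra.
pose i0 : option ('I_n.+1 * 'I_S * 'I_m) := Some (k, Ordinal sS, Ordinal tm).
apply: (@source_past _ _ _ _ _ _ _ _ _ x0 xi s t.+1 i0).
  by rewrite /= eqxx ltnS leqnn orbT.
by exists B.
Qed.

Lemma adapted_sample_gradient k s t X : (s < S)%N -> (t < m)%N ->
  adapted s t X -> adapted s t.+1 (fun w => sgrad (X w) (xi k s t w)).
Proof.
move=> sS tm aX.
have mX := vmeasurable_sample_gradient_comp L0 fG oracle (k := k) aX.
pose U (w : pastT s t.+1) : pastT s t * Xi k := (w, xi k s t w).
have mU : measurable_fun setT U.
  apply: measurable_fun_pair; last exact: measurable_sample_past.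
  by apply: measurable_pastT_le; rewrite eqxx leqnSn orbT.
exact: (vmeasurable_comp mU mX).
Qed.

Lemma vmeasurable_local_gradient k d1 (T : measurableType d1) (X : T -> 'rV[R]_d) :
  vmeasurable X -> vmeasurable (fun w => lgrad k (X w)).
Proof.
move=> mX i.
have cG := smooth_convex_gradient_continuous (i := i) L0 (local_smooth k).
exact: (measurable_continuous_comp cG mX).
Qed.

Lemma vmeasurable_global_gradient d1 (T : measurableType d1) (X : T -> 'rV[R]_d) :
  vmeasurable X -> vmeasurable (fun w => global_gradient (X w)).
Proof.
by move=> mX; apply: vmeasurable_average => k; exact: vmeasurable_local_gradient.
Qed.

(** Comparison with the gradient at the origin, by the Lipschitz bound. *)
Lemma vbounded_local_gradient k (T : Type) (X : T -> 'rV[R]_d) :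
  vbounded X -> vbounded (fun w => lgrad k (X w)).
Proof.
move=> bX; have [M XM] := vboundedB bX (vbounded_cst 0).
have : vbounded (fun w => lgrad k (X w) - lgrad k 0).
  exists (4 * L ^+ 2 * M) => w.
  apply: (le_trans (smooth_convex_lipschitz L0 (local_smooth k) _ _)).
  by rewrite ler_wpM2l// mulr_ge0// sqr_ge0.
move=> /vboundedD /(_ (vbounded_cst (lgrad k 0))).
by under eq_fun do rewrite subrK.
Qed.

Lemma vbounded_global_gradient (T : Type) (X : T -> 'rV[R]_d) :
  vbounded X -> vbounded (fun w => global_gradient (X w)).
Proof.
by move=> bX; apply: vbounded_average => k; exact: vbounded_local_gradient.
Qed.

Lemma objective_smooth_convex :
  smooth_convex L (objective D f) global_gradient.
Proof.
move=> x y; rewrite dotp_averagel /objective -mulrBr -sumrB.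
rewrite -/(mean (fun k => local_objective D f k y - local_objective D f k x)).
rewrite -[L * _](@mean_cst _ n) -meanD.
by apply/andP; split; apply: le_mean => k; case/andP: (local_smooth k x y).
Qed.

Section Stage.
Variables (T : Type) (xt y : T -> 'rV[R]_d) (z : forall k, nat -> T -> Xi k).

Definition iterate t k w :=
  local_iterate D f I eta (xt w) (y w) (fun k t => z k t w) t k.

Definition stoch_gradient t k w :=
  sgrad (iterate t k w) (z k t w) - sgrad (xt w) (z k t w) + global_gradient (xt w).

(** The one-step estimate is made for this state; a synchronization is accounted for afterwards. *)
Definition presync t k w := iterate t k w - eta *: stoch_gradient t k w.

Lemma iterateS t k : iterate t.+1 k =
  fun w => if I t.+1 then average (presync t ^~ w) else presync t k w.
Proof. by apply: funext => w; rewrite /presync /iterate /=; case: (I t.+1). Qed.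

Lemma vbounded_presync t k : (forall j, vbounded (iterate t j)) -> vbounded xt ->
  vbounded (presync t k).
Proof.
move=> bx bxt; apply: vboundedB; first exact: bx.
apply/vboundedZ/vboundedD; last exact: vbounded_global_gradient.
exact: (vbounded_comp (fun w => (w, z k t w))
  (vbounded_sample_gradientB L0 fG k (bx k) bxt)).
Qed.

Lemma vbounded_iterate t k : vbounded xt -> vbounded y -> vbounded (iterate t k).
Proof.
move=> bxt by0; elim: t k => [//|t IH] k.
have bx' j : vbounded (presync t j) by exact: vbounded_presync.
rewrite iterateS; case: (I t.+1) => //.
exact: (vbounded_average (X := presync t)).
Qed.

Lemma vbounded_next_reference (x : nat -> 'I_n.+1 -> T -> 'rV[R]_d) :
  (forall t k, vbounded (x t k)) ->
  vbounded (fun w => next_reference m mu eta (fun t k => x t k w)).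
Proof.
move=> bx; apply/vboundedZ/vbounded_sum => i; apply: vboundedZ.
exact: vbounded_average.
Qed.

End Stage.

Lemma vmeasurable_next_reference d1 (T : measurableType d1)
    (x : nat -> 'I_n.+1 -> T -> 'rV[R]_d) :
  (forall t k, (t < m)%N -> vmeasurable (x t k)) ->
  vmeasurable (fun w => next_reference m mu eta (fun t k => x t k w)).
Proof.
move=> mx; apply/vmeasurableZ/vmeasurable_sum => i; apply: vmeasurableZ.
apply: vmeasurable_average => k; apply: mx.
by rewrite -subnDA ltn_subrL addn1 /= (leq_ltn_trans _ (ltn_ord i)).
Qed.

Lemma adapted_presync (xt y : Omega -> 'rV[R]_d) s t k : (s < S)%N -> (t < m)%N ->
  adapted s 0 xt ->
  (forall j, adapted s t (iterate xt y (fun k => xi k s) t j)) ->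
  adapted s t.+1 (presync xt y (fun k => xi k s) t k).
Proof.
move=> sS tm axt ax.
have axt' u : adapted s u xt by apply: adapted_le axt; rewrite eqxx leq0n orbT.
apply: vmeasurableB; first by apply: adapted_le (ax k); rewrite eqxx leqnSn orbT.
apply: vmeasurableZ; apply: vmeasurableD.
  apply: vmeasurableB; first exact: adapted_sample_gradient sS tm (ax k).
  exact: adapted_sample_gradient sS tm (axt' t).
exact: vmeasurable_global_gradient (axt' _).
Qed.

Lemma adapted_iterate (xt y : Omega -> 'rV[R]_d) s t k : (s < S)%N -> (t <= m)%N ->
  adapted s 0 xt -> adapted s 0 y ->
  adapted s t (iterate xt y (fun k => xi k s) t k).
Proof.
move=> sS tm axt ay; elim: t k tm => [//|t IH] k tm.
have ax' j : adapted s t.+1 (presync xt y (fun k => xi k s) t j).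
  by apply: adapted_presync => // i; exact: IH (ltnW tm).
rewrite iterateS; case: (I t.+1) => //.
exact: (@vmeasurable_average R d _ (pastT s t.+1) n _ ax').
Qed.

(** The starting point is a parameter because the same samples are run from [x0] and from its
    truncation. *)
Definition stage_at (X : Omega -> 'rV[R]_d) s w :=
  stage D f m I mu eta (X w) (fun k s t => xi k s t w) s.

Definition reference X s w := (stage_at X s w).1.
Definition start X s w := (stage_at X s w).2.

Definition stage_iterate X s := iterate (reference X s) (start X s) (fun k => xi k s).

Lemma referenceS X s w : reference X s.+1 w =
  next_reference m mu eta (fun t k => stage_iterate X s t k w).
Proof. by []. Qed.

Lemma startS X s w : start X s.+1 w = average (fun k => stage_iterate X s m k w).
Proof. by []. Qed.

Lemma vbounded_stage X s : vbounded X ->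
  vbounded (reference X s) /\ vbounded (start X s).
Proof.
move=> bX; elim: s => [//|s [IH1 IH2]]; split.
  apply: (vbounded_next_reference (x := fun t k => stage_iterate X s t k)).
  by move=> t k; exact: vbounded_iterate.
by apply: (vbounded_average (X := stage_iterate X s m)) => k; exact: vbounded_iterate.
Qed.

Lemma adapted_stage X s : (s <= S)%N -> adapted 0 0 X ->
  adapted s 0 (reference X s) /\ adapted s 0 (start X s).
Proof.
move=> sS aX; elim: s sS => [//|s IH] sS.
have [a1 a2] := IH (ltnW sS).
have ai t k : (t <= m)%N -> adapted s.+1 0 (stage_iterate X s t k).
  move=> tm; apply: (@adapted_le s t); first by rewrite ltnSn.
  exact: adapted_iterate.
split.
  apply: (@vmeasurable_next_reference _ (pastT s.+1 0) (stage_iterate X s)).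
  by move=> t k tm; apply: ai; exact: ltnW.
exact: (@vmeasurable_average R d _ (pastT s.+1 0) n _ (fun k => ai m k (leqnn m))).
Qed.

Definition output X w :=
  svrg_output D f m I mu eta S (X w) (fun k s t => xi k s t w).

Lemma outputE X : output X =
  if mu == 0 then fun w => S%:R^-1 *: \sum_(i < S) reference X i.+1 w
  else reference X S.
Proof.
apply: funext => w; rewrite /output /svrg_output; case: ifP => // _.
by rewrite big_add1 big_mkord.
Qed.

Lemma vbounded_output X : vbounded X -> vbounded (output X).
Proof.
move=> bX; have br s : vbounded (reference X s) by case: (vbounded_stage s bX).
rewrite outputE; case: ifP => // _.
by apply: vboundedZ; exact: vbounded_sum.
Qed.

Lemma vmeasurable_output X : adapted 0 0 X -> vmeasurable (output X).
Proof.
move=> aX; have mr s : (s <= S)%N -> vmeasurable (reference X s).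
  by move=> /adapted_stage/(_ aX)[+ _]; exact: adapted_vmeasurable.
rewrite outputE; case: ifP => _; last exact: mr.
by apply: vmeasurableZ; apply: vmeasurable_sum => i; exact: mr.
Qed.

End Iterates.

(** * Time since the last synchronization, against the gap *)

Section SynchronizationGap.
Implicit Types (I : pred nat) (m t : nat).

Fixpoint since_sync I t :=
  if t is t'.+1 then if I t'.+1 then 0%N else (since_sync I t').+1 else 0%N.

Lemma mem_zip_behead (T : eqType) (u v : seq T) (a b : T) :
  (a, b) \in zip (u ++ [:: a, b & v]) (behead (u ++ [:: a, b & v])).
Proof.
elim: u => [|x u IH] /=; first by rewrite inE eqxx.
by case: u IH => [|y u] /= IH; rewrite inE IH orbT.
Qed.

(** The last synchronization up to [t] and the first one after [t], which exists because [m] counts,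
    are consecutive in the sorted list; their difference exceeds the time since the former. *)
Lemma since_sync_lt_gap m I t : (t < m)%N -> (since_sync I t < gap m I)%N.
Proof.
move=> tm; rewrite /gap; set p := fun t => _; set s := [seq _ <- _ | _].
have sE : s = [seq t <- iota 0 t.+1 | p t] ++ [seq t <- iota t.+1 (m - t) | p t].
  by rewrite -filter_cat -[X in iota X _]add0n -iotaD addSn subnKC// ltnW.
have [u uE] : exists u,
    [seq t <- iota 0 t.+1 | p t] = rcons u (t - since_sync I t)%N.
  elim: t tm {sE} => [|t IH] tm; first by exists [::].
  have [u uE] := IH (ltnW tm).
  rewrite -[t.+2]addn1 iotaD filter_cat uE add0n /= /p /= ltn_eqF//=.
  case: (I t.+1); first by exists (rcons u (t - since_sync I t)%N); rewrite cats1.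
  by exists u; rewrite cats0.
have : m \in [seq t <- iota t.+1 (m - t) | p t].
  by rewrite mem_filter /p eqxx orbT mem_iota tm addSn subnKC ?ltnSn// ltnW.
case vE : [seq t <- iota t.+1 (m - t) | p t] => [//|b v] _.
have : b \in [seq t <- iota t.+1 (m - t) | p t] by rewrite vE inE eqxx.
rewrite mem_filter mem_iota => /andP[_ /andP[tb _]].
rewrite sE uE vE cat_rcons.
have := @leq_bigmax_seq _ _ xpredT (fun q : nat * nat => q.2 - q.1)%N _
  (mem_zip_behead u v (t - since_sync I t)%N b) isT.
apply: leq_trans => /=.
have st : (since_sync I t <= t)%N.
  by elim: t {tm sE uE vE tb} => [//|t IH] /=; case: (I t.+1).
by rewrite subnBA// ltn_subRL ltn_add2r.
Qed.

End SynchronizationGap.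

Section Jensen.
Context {R : realType} {d : nat}.

(** The supporting hyperplane at the weighted mean is summed; its linear terms cancel. *)
Lemma smooth_convex_jensen L (g : 'rV[R]_d -> R) G (I : finType)
    (c : I -> R) (x : I -> 'rV[R]_d) :
  smooth_convex L g G -> (forall i, 0 <= c i) -> 0 < \sum_i c i ->
  (\sum_i c i) * g ((\sum_i c i)^-1 *: \sum_i c i *: x i) <= \sum_i c i * g (x i).
Proof.
move=> gG c0 W0; set W := \sum_i c i in W0 *; set p := W^-1 *: _.
rewrite /W mulr_suml -subr_ge0 -sumrB.
have : \sum_i dotp (G p) (c i *: (x i - p)) <= \sum_i (c i * g (x i) - c i * g p).
  apply: ler_sum => i _; rewrite -mulrBr dotpZr ler_wpM2l//.
  by case/andP: (gG p (x i)).
apply: le_trans; under eq_bigr do rewrite dotpC.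
rewrite -dotp_suml; under eq_bigr do rewrite scalerBr.
rewrite sumrB -scaler_suml -/W /p scalerA divff ?gt_eqF// scale1r subrr.
by rewrite dotp0l.
Qed.

End Jensen.

(** * Stages and rates *)

Section StochasticStep.
Context {R : realType} {n d : nat} {dX dO : measure_display}.
Context {Xi : 'I_n.+1 -> measurableType dX} {Omega : measurableType dO}.
Variables (P : probability Omega R) (D : forall k, probability (Xi k) R).
Variable f : forall k, 'rV[R]_d -> Xi k -> R.
Variables (L mu eta : R) (S m E : nat) (I : pred nat) (xs : 'rV[R]_d).
Variables (x0 : Omega -> 'rV[R]_d) (xi : forall k, nat -> nat -> Omega -> Xi k).
Hypotheses (L0 : 0 < L) (mu0 : 0 <= mu) (muL : mu <= 2 * L) (eta0 : 0 < eta).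
Hypotheses (E1 : (1 <= E)%N) (etaLE : 1000 * (eta * L * E%:R) <= 1).
Hypothesis fG : forall k (z : Xi k),
  smooth_convex L (fun x => f x z) (fun x => sample_gradient f x z).
Hypothesis oracle : forall k, stochastic_oracle D f k.
Hypothesis strong : forall k, strongly_convex mu (local_objective D f k).
Hypothesis xs_min : minimizer (objective D f) xs.
Hypothesis hs : independent_sampling P D S m x0 xi.

Local Notation sgrad := (sample_gradient f).
Local Notation lgrad := (local_gradient D f).
Local Notation adapted := (adapted S m x0 xi).
Local Notation pastT := (pastT S m x0 xi).

Definition excess x := objective D f x - objective D f xs.

Lemma global_gradient_minimizer : global_gradient D f xs = 0.
Proof.
exact: (smooth_convex_minimizer L0 (objective_smooth_convex fG oracle) xs_min).
Qed.

Lemma excess_ge0 x : 0 <= excess x.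
Proof. by rewrite subr_ge0; exact: xs_min. Qed.

Lemma excess_le x : excess x <= L * sqn (x - xs).
Proof.
have /andP[_] := objective_smooth_convex fG oracle xs x.
by rewrite global_gradient_minimizer dotp0l add0r.
Qed.

Lemma measurable_excess d1 (T : measurableType d1) (X : T -> 'rV[R]_d) :
  vmeasurable X -> measurable_fun setT (fun w => excess (X w)).
Proof.
move=> mX; apply: measurable_funB; last exact: measurable_cst.
apply: (measurable_continuous_comp (g := objective D f)) mX.
exact: (smooth_convex_continuous L0 (objective_smooth_convex fG oracle)).
Qed.

Lemma rbounded_excess (T : Type) (X : T -> 'rV[R]_d) :
  vbounded X -> rbounded (fun w => excess (X w)).
Proof.
move=> bX; apply: (rbounded_ge0_le (g := fun w => L * sqn (X w - xs))).
  by move=> w; rewrite excess_ge0 excess_le.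
by apply/rboundedZ/rbounded_sqn/vboundedB; last exact: vbounded_cst.
Qed.

Lemma integrable_excess (X : Omega -> 'rV[R]_d) :
  vmeasurable X -> vbounded X -> P.-integrable setT (EFin \o (fun w => excess (X w))).
Proof.
by move=> mX bX; apply: bounded_integrable; [exact: measurable_excess|exact: rbounded_excess].
Qed.

Lemma measurable_sqn_dev d1 (T : measurableType d1) (x : 'I_n.+1 -> T -> 'rV[R]_d) :
  (forall k, vmeasurable (x k)) ->
  measurable_fun setT (fun w => mean (fun k => sqn (x k w - average (x ^~ w)))).
Proof.
move=> mx; apply: (measurable_mean (X := fun k w => sqn (x k w - average (x ^~ w)))).
move=> k; apply: measurable_sqn; apply: vmeasurableB => //.
exact: vmeasurable_average.
Qed.

Lemma rbounded_sqn_dev (T : Type) (x : 'I_n.+1 -> T -> 'rV[R]_d) :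
  (forall k, vbounded (x k)) ->
  rbounded (fun w => mean (fun k => sqn (x k w - average (x ^~ w)))).
Proof.
move=> bx; apply: (rbounded_mean (f := fun k w => sqn (x k w - average (x ^~ w)))).
by move=> k; apply/rbounded_sqn/vboundedB => //; exact: vbounded_average.
Qed.

Lemma integrable_lyapunov b (x : 'I_n.+1 -> Omega -> 'rV[R]_d) :
  (forall k, vmeasurable (x k)) -> (forall k, vbounded (x k)) ->
  P.-integrable setT (EFin \o (fun w => lyapunov L eta xs b (x ^~ w))).
Proof.
move=> mx bx; apply: bounded_integrable.
  apply: measurable_funD.
    apply: measurable_sqn; apply: vmeasurableB; last exact: vmeasurable_cst.
    exact: vmeasurable_average.
  by apply: measurable_funM => //; exact: measurable_sqn_dev.
apply: rboundedD; last by apply: rboundedZ; exact: rbounded_sqn_dev.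
by apply/rbounded_sqn/vboundedB; [exact: vbounded_average|exact: vbounded_cst].
Qed.

(** The contribution of one machine to the sample-dependent part of the pathwise bound, with the
    state frozen. *)
Definition sample_noise a k (x xt h xb : 'rV[R]_d) (z : Xi k) : R :=
  - (2 * eta) * dotp (sgrad x z - sgrad xt z + h) (xb - xs) +
  noise_weight L eta E%:R a *
    (sqn (sgrad xb z - sgrad xs z) + sqn (sgrad xt z - sgrad xs z)).

Let E1R : 1 <= E%:R :> R. Proof. by rewrite ler1n. Qed.

Lemma Rintegral_sample_noise_le a k x xt h xb : 0 <= a ->
  \int[D k]_z sample_noise a x xt h xb z <=
  - (2 * eta) * dotp (lgrad k x - lgrad k xt + h) (xb - xs) +
  noise_weight L eta E%:R a * (4 * L * breg D f k xb xs + 4 * L * breg D f k xt xs).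
Proof.
move=> a0; have nw0 : 0 <= noise_weight L eta E%:R a.
  rewrite /noise_weight /drift_weight mulr_ge0// mulr_ge0 ?sqr_ge0// addr_ge0//.
  by rewrite !mulr_ge0// ltW.
have [ix ex] := integrable_dotp_sample_gradient oracle k x (xb - xs).
have [it et] := integrable_dotp_sample_gradient oracle k xt (xb - xs).
have [ib eb] := sqn_sample_gradient_le L0 fG oracle k xb xs.
have [jt ft] := sqn_sample_gradient_le L0 fG oracle k xt xs.
have ih : (D k).-integrable setT (EFin \o (fun=> dotp h (xb - xs))).
  exact: finite_measure_integrable_cst.
have i1 := integrableB measurableT ix it.
have i2 := integrableD measurableT i1 ih.
have i3 := integrableZl measurableT (- (2 * eta)) i2.
have i4 := integrableD measurableT ib jt.
have i5 := integrableZl measurableT (noise_weight L eta E%:R a) i4.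
under eq_Rintegral do rewrite /sample_noise !dotpDl dotpNl.
rewrite RintegralD// RintegralZl// RintegralD//.
rewrite RintegralZl// RintegralD// RintegralB// ex et.
have -> : \int[D k]_z dotp h (xb - xs) = dotp h (xb - xs).
  transitivity (dotp h (xb - xs) * fine (D k setT)); first by rewrite Rintegral_cst.
  by rewrite probability_setT mulr1.
by apply: lerD; [rewrite !dotpDl dotpNl|rewrite ler_wpM2l// lerD].
Qed.

Section Step.
Variables (s t : nat) (sS : (s < S)%N) (tm : (t < m)%N) (a : R).
Hypotheses (a0 : 0 <= a) (aE : a + 1 <= 2 * E%:R).
Variables (x : 'I_n.+1 -> Omega -> 'rV[R]_d) (xt : Omega -> 'rV[R]_d).
Hypotheses (ax : forall k, adapted s t (x k)) (axt : adapted s t xt).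
Hypotheses (bx : forall k, vbounded (x k)) (bxt : vbounded xt).

Let h w := global_gradient D f (xt w).
Let xb w := average (x ^~ w).
Let V w := mean (fun k => sqn (x k w - xb w)).
Let noise k (p : pastT s t * Xi k) : R :=
  sample_noise a (x k p.1) (xt p.1) (h p.1) (xb p.1) p.2.

Let axb : adapted s t xb.
Proof. exact: (@vmeasurable_average R d _ (pastT s t) n x ax). Qed.

Let ah : adapted s t h.
Proof. exact: (vmeasurable_global_gradient L0 fG oracle axt). Qed.

Let bxb : vbounded xb. Proof. exact: vbounded_average. Qed.

Let bh : vbounded h. Proof. exact: (vbounded_global_gradient L0 fG oracle bxt). Qed.

Let measurable_noise k : measurable_fun setT (@noise k).
Proof.
have msg := vmeasurable_sample_gradient_comp L0 fG oracle (k := k).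
have m1 (X : Omega -> 'rV[R]_d) : adapted s t X ->
    vmeasurable (fun p : pastT s t * Xi k => X p.1).
  by move=> aX; exact: (vmeasurable_comp measurable_fst aX).
apply: measurable_funD; apply: measurable_funM => //.
  apply: measurable_dotp.
    by apply: vmeasurableD; [apply: vmeasurableB; apply: msg; [exact: ax|]|exact: m1].
  by apply: vmeasurableB; [exact: m1|exact: vmeasurable_cst].
apply: measurable_funD; apply: measurable_sqn; apply: vmeasurableB.
- exact: (msg _ _ _ axb).
- by apply: (msg _ (pastT s t) (fun=> xs)); exact: vmeasurable_cst.
- exact: (msg _ _ _ axt).
- by apply: (msg _ (pastT s t) (fun=> xs)); exact: vmeasurable_cst.
Qed.

Let rbounded_noise k : rbounded (@noise k).
Proof.
have bsg := vbounded_sample_gradientB L0 fG k.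
have b1 (X : Omega -> 'rV[R]_d) : vbounded X ->
    vbounded (fun p : pastT s t * Xi k => X p.1).
  exact: vbounded_comp.
apply: rboundedD; apply: rboundedZ.
  apply: rbounded_dotp.
    by apply: vboundedD; [exact: bsg|exact: b1].
  by apply: vboundedB; [exact: b1|exact: vbounded_cst].
apply: rboundedD; apply: rbounded_sqn.
  exact: (bsg _ xb (fun=> xs) bxb (vbounded_cst xs)).
exact: (bsg _ xt (fun=> xs) bxt (vbounded_cst xs)).
Qed.

(** With the identity into [pastT s t] as first variable, the whole state is frozen at once and only
    the fresh sample is integrated. *)
Let Rintegral_noise k :
  \int[P]_w noise (w, xi k s t w) = \int[P]_w (\int[D k]_z noise (w, z)).
Proof.
apply: (Rintegral_independent (@measurable_noise k) (@rbounded_noise k)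
  (U := id : Omega -> pastT s t)).
- exact: (measurable_pastT hs).
- exact: (measurable_sample hs sS tm).
- by move=> A B mA mB; exact: (past_independent hs sS tm mA mB).
Qed.

(** The pathwise bound is integrated, the sample of each machine is integrated out by independence,
    and the deterministic bound closes the step. *)
Lemma lyapunov_step (x' : 'I_n.+1 -> Omega -> 'rV[R]_d) :
  (forall k w, x' k w = x k w -
    eta *: (sgrad (x k w) (xi k s t w) - sgrad (xt w) (xi k s t w) + h w)) ->
  (forall k, vmeasurable (x' k)) -> (forall k, vbounded (x' k)) ->
  \int[P]_w lyapunov L eta xs a (x' ^~ w) <=
  (1 - mu * eta) * \int[P]_w lyapunov L eta xs (a + 1) (x ^~ w)
  - 3 / 2 * eta * \int[P]_w excess (xb w) + 1 / 2 * eta * \int[P]_w excess (xt w).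
Proof.
move=> x'E mx' bx'.
have mpast := @measurable_pastT _ _ _ _ _ _ _ _ _ _ _ _ _ hs s t.
have mx k : vmeasurable (x k) := adapted_vmeasurable hs (ax k).
have mxt : vmeasurable xt := adapted_vmeasurable hs axt.
have mh : vmeasurable h := adapted_vmeasurable hs ah.
have mxb : vmeasurable xb := adapted_vmeasurable hs axb.
pose rest w := sqn (xb w - xs) + drift_weight L eta a * (1 + (4 * E%:R)^-1) * V w +
  noise_weight L eta E%:R a * (4 * L ^+ 2 * V w + sqn (h w)).
have irest : P.-integrable setT (EFin \o rest).
  apply: bounded_integrable.
    apply: measurable_funD; first apply: measurable_funD.
    - by apply: measurable_sqn; apply: vmeasurableB => //; exact: vmeasurable_cst.
    - by apply: measurable_funM => //; exact: measurable_sqn_dev.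
    apply: measurable_funM => //; apply: measurable_funD; last exact: measurable_sqn.
    by apply: measurable_funM => //; exact: measurable_sqn_dev.
  apply: rboundedD; first apply: rboundedD.
  - by apply/rbounded_sqn/vboundedB => //; exact: vbounded_cst.
  - by apply: rboundedZ; exact: rbounded_sqn_dev.
  apply/rboundedZ/rboundedD; last exact: rbounded_sqn.
  by apply: rboundedZ; exact: rbounded_sqn_dev.
have iN k : P.-integrable setT (EFin \o (fun w => noise (w, xi k s t w))).
  apply: bounded_integrable.
    apply: (measurableT_comp (@measurable_noise k)).
    by apply: measurable_fun_pair => //; exact: (measurable_sample hs sS tm).
  by have [M NM] := @rbounded_noise k; exists M => w; exact: NM.
have iNN k : P.-integrable setT (EFin \o (fun w => \int[D k]_z noise (w, z))).
  apply: bounded_integrable.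
    exact: (measurableT_comp
      (measurable_Rintegral_section (D k) (@measurable_noise k) (@rbounded_noise k))
      mpast).
  have [M NM] := rbounded_Rintegral_section (D k) (@measurable_noise k) (@rbounded_noise k).
  by exists M => w; exact: NM.
have imean (F : 'I_n.+1 -> Omega -> R) :
    (forall k, P.-integrable setT (EFin \o F k)) ->
    P.-integrable setT (EFin \o (fun w => mean (F ^~ w))).
  move=> /(integrable_Rintegral_sum (index_enum 'I_n.+1))[iF _].
  exact: (integrableZl measurableT _ iF).
have iL := integrable_lyapunov a mx' bx'.
have iL1 := integrable_lyapunov (a + 1) mx bx.
have ib := integrable_excess mxb bxb.
have it := integrable_excess mxt bxt.
have iL1' := integrableZl measurableT (1 - mu * eta) iL1.
have ib' := integrableZl measurableT (3 / 2 * eta) ib.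
have it' := integrableZl measurableT (1 / 2 * eta) it.
have iLb := integrableB measurableT iL1' ib'.
have iT := integrableD measurableT iLb it'.
have iN' := imean _ iN.
have iNN' := imean _ iNN.
have irN := integrableD measurableT irest iN'.
have irNN := integrableD measurableT irest iNN'.
apply: (@le_trans _ _ (\int[P]_w (rest w + mean (fun k => noise (w, xi k s t w))))).
  apply: le_Rintegral => // w _.
  have := lyapunov_step_pathwise xs L0 eta0 E1R a0 (fun k => x k w) (xt w) (h w)
    (fun k => fG (xi k s t w)).
  rewrite /= (_ : (fun k => _) = x' ^~ w)//.
  by apply: funext => k; rewrite x'E.
rewrite RintegralD// Rintegral_mean//.
under eq_mean do rewrite Rintegral_noise.
rewrite -Rintegral_mean// -RintegralD//.
have <- : \int[P]_w ((1 - mu * eta) * lyapunov L eta xs (a + 1) (x ^~ w) -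
    3 / 2 * eta * excess (xb w) + 1 / 2 * eta * excess (xt w)) =
  (1 - mu * eta) * \int[P]_w lyapunov L eta xs (a + 1) (x ^~ w)
  - 3 / 2 * eta * \int[P]_w excess (xb w) + 1 / 2 * eta * \int[P]_w excess (xt w).
  by rewrite RintegralD// RintegralB// !RintegralZl.
apply: le_Rintegral => // w _.
have strong' k y z : dotp (lgrad k y) (z - y) + mu / 2 * sqn (y - z) <=
    local_objective D f k z - local_objective D f k y.
  by rewrite -sqr_enorm; exact: strong.
have step := lyapunov_step_mean L0 mu0 muL eta0 E1R etaLE a0 aE
  (fun k => x k w) (xt w) (local_objective_smooth_convex fG oracle) strong'
  global_gradient_minimizer.
apply: le_trans step.
apply: lerD; first exact: lexx.
apply: le_mean => k.
have := @Rintegral_sample_noise_le a k (x k w) (xt w) (h w) (xb w) a0.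
by rewrite /breg; exact.
Qed.

End Step.
End StochasticStep.

(** * Scalar recurrences *)

Section Recurrences.
Context {R : realType}.
Implicit Types (u c a b : nat -> R) (r rho : R).

Lemma geometric_unroll r u c m : 0 <= r ->
  (forall t, (t < m)%N -> u t.+1 <= r * u t - c t) ->
  u m <= r ^+ m * u 0%N - \sum_(i < m) r ^+ (m - i.+1) * c i.
Proof.
move=> r0; elim: m => [|m IH] uc; first by rewrite big_ord0 mul1r subr0.
rewrite big_ord_recr /= subnn mul1r.
under eq_bigr => i _ do rewrite (subSn (ltn_ord i)) exprS -mulrA.
rewrite -mulr_sumr; apply: (le_trans (uc m (ltnSn m))).
have := ler_wpM2l r0 (IH (fun t tm => uc t (ltnW tm))); rewrite exprS; lra.
Qed.

(** Each [b s] is gained with 3/2 in one inequality and spent with 1/2 in the next, so one full copy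
    survives. *)
Lemma telescope_bound a b S :
  (forall s, (s < S)%N -> a s.+1 + 3 / 2 * b s.+1 <= a s + 1 / 2 * b s) ->
  a S + 1 / 2 * b S + \sum_(1 <= s < S.+1) b s <= a 0%N + 1 / 2 * b 0%N.
Proof.
elim: S => [|S IH] ab; first by rewrite big_geq// addr0.
rewrite big_nat_recr//=; have := IH (fun s sS => ab s (ltnW sS)).
have := ab S (ltnSn S); lra.
Qed.

(** Since 1/2 is a third of 3/2, the quantity [a + 3 / 2 b] contracts by any factor above both [r]
    and 1/3. *)
Lemma linear_rate_bound r rho a b S : r <= rho -> 1 / 3 <= rho ->
  (forall s, (s <= S)%N -> 0 <= a s) -> (forall s, (s <= S)%N -> 0 <= b s) ->
  (forall s, (s < S)%N -> a s.+1 + 3 / 2 * b s.+1 <= r * a s + 1 / 2 * b s) ->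
  a S + 3 / 2 * b S <= rho ^+ S * (a 0%N + 3 / 2 * b 0%N).
Proof.
move=> rrho rho3; elim: S => [|S IH] a0 b0 ab; first by rewrite mul1r.
have {}IH : a S + 3 / 2 * b S <= rho ^+ S * (a 0%N + 3 / 2 * b 0%N).
  by apply: IH => s sS; [apply: a0|apply: b0|apply: ab]; exact: ltnW.
have rho0 : 0 <= rho by lra.
rewrite exprS -[leRHS]mulrA; apply: le_trans (ler_wpM2l rho0 IH).
apply: (le_trans (ab S (ltnSn S))); rewrite mulrDr.
apply: lerD; first by rewrite ler_wpM2r// a0.
by rewrite mulrA ler_wpM2r ?b0//; lra.
Qed.

End Recurrences.

(** * From steps to stages, and from stages to the output *)

Section StageAnalysis.
Context {R : realType} {n d : nat} {dX dO : measure_display}.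
Context {Xi : 'I_n.+1 -> measurableType dX} {Omega : measurableType dO}.
Variables (P : probability Omega R) (D : forall k, probability (Xi k) R).
Variable f : forall k, 'rV[R]_d -> Xi k -> R.
Variables (L mu eta : R) (S m : nat) (I : pred nat) (xs : 'rV[R]_d).
Variables (x0 : Omega -> 'rV[R]_d) (xi : forall k, nat -> nat -> Omega -> Xi k).
Let E := gap m I.
Hypotheses (L0 : 0 < L) (mu0 : 0 <= mu) (muL : mu <= 2 * L) (eta0 : 0 < eta).
Hypotheses (E1 : (1 <= E)%N) (etaLE : 1000 * (eta * L * E%:R) <= 1).
Hypothesis m0 : (0 < m)%N.
Hypothesis fG : forall k (z : Xi k),
  smooth_convex L (fun x => f x z) (fun x => sample_gradient f x z).
Hypothesis oracle : forall k, stochastic_oracle D f k.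
Hypothesis strong : forall k, strongly_convex mu (local_objective D f k).
Hypothesis xs_min : minimizer (objective D f) xs.
Hypothesis hs : independent_sampling P D S m x0 xi.
Variable X : Omega -> 'rV[R]_d.
Hypotheses (aX : adapted S m x0 xi 0 0 X) (bX : vbounded X).

Local Notation excess := (excess D f xs).
Local Notation iter_at := (stage_iterate D f mu eta m I xi X).
Local Notation ref_at := (reference D f mu eta m I xi X).
Local Notation start_at := (start D f mu eta m I xi X).
Local Notation adapted := (adapted S m x0 xi).
Local Notation sum_weights := (\sum_(j < m) (1 - mu * eta) ^+ j).

Let b_ref s : vbounded (ref_at s).
Proof. by have [] := vbounded_stage mu eta m I xi L0 fG oracle s bX. Qed.

Let b_start s : vbounded (start_at s).
Proof. by have [] := vbounded_stage mu eta m I xi L0 fG oracle s bX. Qed.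

Let a_ref s : (s <= S)%N -> adapted s 0 (ref_at s).
Proof. by move=> sS; have [] := adapted_stage mu eta I L0 fG oracle sS aX. Qed.

Let a_start s : (s <= S)%N -> adapted s 0 (start_at s).
Proof. by move=> sS; have [] := adapted_stage mu eta I L0 fG oracle sS aX. Qed.

Let b_iter s t k : vbounded (iter_at s t k).
Proof.
exact: (vbounded_iterate eta I L0 fG oracle (fun k => xi k s) t k (b_ref s) (b_start s)).
Qed.

Let a_iter s t k : (s < S)%N -> (t <= m)%N -> adapted s t (iter_at s t k).
Proof.
move=> sS tm.
exact: (adapted_iterate eta I L0 fG oracle k sS tm (a_ref (ltnW sS)) (a_start (ltnW sS))).
Qed.

Definition dist s := \int[P]_w sqn (start_at s w - xs).
Definition ref_excess s := \int[P]_w excess (ref_at s w).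
Definition iter_excess s t := \int[P]_w excess (average (iter_at s t ^~ w)).

Definition potential s t :=
  \int[P]_w lyapunov L eta xs (2 * E%:R - (since_sync I t)%:R) (iter_at s t ^~ w).

Let since_le t : (t < m)%N -> (since_sync I t).+1%:R <= E%:R :> R.
Proof. by move=> tm; rewrite ler_nat; exact: since_sync_lt_gap. Qed.

Lemma lyapunov_consensus b x : lyapunov L eta xs b (fun _ : 'I_n.+1 => x) = sqn (x - xs).
Proof.
rewrite /lyapunov average_cst.
under eq_mean do rewrite subrr sqn0.
by rewrite mean_cst mulr0 addr0.
Qed.

Lemma sqn_le_lyapunov b (x : 'I_n.+1 -> 'rV[R]_d) : 0 <= b ->
  sqn (average x - xs) <= lyapunov L eta xs b x.
Proof.
move=> b0; rewrite lerDl mulr_ge0//.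
  by rewrite !mulr_ge0// ltW.
by apply: mean_ge0 => k; exact: sqn_ge0.
Qed.

Lemma potential_step s t : (s < S)%N -> (t < m)%N ->
  potential s t.+1 <= (1 - mu * eta) * potential s t -
    (3 / 2 * eta * iter_excess s t - 1 / 2 * eta * ref_excess s).
Proof.
move=> sS tm; have Et := since_le tm.
(* The weight index after a step without synchronization, hence the extra 1. *)
pose a : R := 2 * E%:R - (since_sync I t)%:R - 1.
have E1R : 1 <= E%:R :> R by rewrite ler1n.
have a0 : 0 <= a by rewrite /a; move: Et; rewrite -[_.+1%:R]natr1; lra.
have aE : a + 1 <= 2 * E%:R by rewrite /a subrK gerBl.
pose x' := presync D f eta I (ref_at s) (start_at s) (fun k => xi k s) t.
have x'E k w : x' k w = iter_at s t k w - eta *: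
    (sample_gradient f (iter_at s t k w) (xi k s t w) -
     sample_gradient f (ref_at s w) (xi k s t w) + global_gradient D f (ref_at s w)).
  by [].
have bx' k : vbounded (x' k).
  exact: (vbounded_presync L0 fG oracle k (b_iter s t) (b_ref s)).
have mx' k : vmeasurable (x' k).
  exact: (adapted_vmeasurable hs (adapted_presync L0 fG oracle k sS tm
    (a_ref (ltnW sS)) (fun j => a_iter j sS (ltnW tm)))).
have aref : adapted s t (ref_at s).
  by apply: (adapted_le _ (a_ref (ltnW sS))); rewrite eqxx leq0n orbT.
have := lyapunov_step L0 mu0 muL eta0 E1 etaLE fG oracle strong xs_min hs sS tm a0 aE
  (fun k => a_iter k sS (ltnW tm)) aref (b_iter s t) (b_ref s) x'E mx' bx'.
rewrite /a subrK -/a -/(potential s t) -/(iter_excess s t) -/(ref_excess s) => step.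
apply: (@le_trans _ _ (\int[P]_w lyapunov L eta xs a (x' ^~ w))); last by lra.
have itE w : iter_at s t.+1 ^~ w =
    if I t.+1 then (fun=> average (x' ^~ w)) else x' ^~ w.
  by apply: funext => k; rewrite /stage_iterate iterateS; case: (I t.+1).
apply: le_Rintegral => //.
- apply: integrable_lyapunov => k; last exact: b_iter.
  exact: (adapted_vmeasurable hs (a_iter k sS tm)).
- exact: integrable_lyapunov.
(* Synchronizing keeps the average and removes the drift, so the potential does not grow although
   its weight is reset. *)
move=> w _; rewrite itE /=; case: (I t.+1).
  by rewrite lyapunov_consensus sqn_le_lyapunov.
by rewrite -[(since_sync I t).+1%:R]natr1 opprD addrA.
Qed.

Lemma potential0 s : potential s 0 = dist s.
Proof.
by apply: eq_Rintegral => w _; rewrite -(lyapunov_consensus (2 * E%:R - 0)).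
Qed.

Lemma dist_le_potential s : (s < S)%N -> dist s.+1 <= potential s m.
Proof.
move=> sS; apply: le_Rintegral => //.
- apply: bounded_integrable.
    apply: measurable_sqn; apply: vmeasurableB; last exact: vmeasurable_cst.
    exact: (adapted_vmeasurable hs (a_start sS)).
  by apply/rbounded_sqn/vboundedB => //; exact: vbounded_cst.
- apply: integrable_lyapunov => k; last exact: b_iter.
  exact: (adapted_vmeasurable hs (a_iter k sS (leqnn m))).
move=> w _; rewrite startS sqn_le_lyapunov// subr_ge0.
have E1R : 1 <= E%:R :> R by rewrite ler1n.
(* The gap bound concerns times before [m]; at [m] itself the counter is at most one more than at
   [m - 1], hence at most [E]. *)
case: m m0 since_le => // m' _ /(_ m' (ltnSn m')) Em.
apply: (@le_trans _ _ (since_sync I m').+1%:R); last by lra.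
by rewrite ler_nat /=; case: (I m'.+1).
Qed.

Let W := sum_weights.

Lemma sum_weights_ge1 : 0 <= 1 - mu * eta -> 1 <= W.
Proof.
move=> r0; rewrite /W; case: m m0 => // m' _.
rewrite big_ord_recl expr0 lerDl sumr_ge0// => i _; exact: exprn_ge0.
Qed.

(** After reversing the index, the weights left by unrolling the step recursion are those defining
    the next reference point. *)
Lemma ref_excess_jensen s : (s < S)%N -> 0 <= 1 - mu * eta ->
  W * ref_excess s.+1 <=
  \sum_(i < m) (1 - mu * eta) ^+ (m - i.+1) * iter_excess s i.
Proof.
move=> sS r0; have W0 := lt_le_trans ltr01 (sum_weights_ge1 r0).
rewrite (reindex_inj rev_ord_inj) /=.
have -> : \sum_(i < m) (1 - mu * eta) ^+ (m - (m - i.+1).+1) *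
    iter_excess s (m - i.+1) =
    \sum_(i < m) (1 - mu * eta) ^+ i * iter_excess s (m - i.+1).
  by apply: eq_bigr => i _; rewrite subnSK// subKn// ltnW.
have ie (i : 'I_m) : P.-integrable setT
    (EFin \o (fun w => excess (average (iter_at s (m - i.+1) ^~ w)))).
  apply: (integrable_excess P L0 fG oracle xs_min).
    apply: vmeasurable_average => k.
    exact: (adapted_vmeasurable hs (a_iter k sS (leq_subr _ _))).
  by apply: vbounded_average => k; exact: b_iter.
have ie' (i : 'I_m) := integrableZl measurableT ((1 - mu * eta) ^+ i) (ie i).
have ir : P.-integrable setT (EFin \o (fun w => excess (ref_at s.+1 w))).
  apply: (integrable_excess P L0 fG oracle xs_min) => //.
  exact: (adapted_vmeasurable hs (a_ref sS)).
have [isum sumE] := integrable_Rintegral_sum (index_enum 'I_m) ie'.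
rewrite -RintegralZl//.
under [leRHS]eq_bigr do rewrite -RintegralZl//.
rewrite -sumE; apply: le_Rintegral => //; first exact: (integrableZl measurableT _ ir).
move=> w _; have -> : ref_at s.+1 w = W^-1 *:
    \sum_(i < m) (1 - mu * eta) ^+ i *: average (iter_at s (m - i.+1) ^~ w).
  rewrite referenceS /next_reference; congr (_ *: _); apply: eq_bigr => i _.
  by rewrite -subnDA addn1.
have := smooth_convex_jensen (fun i : 'I_m => average (iter_at s (m - i.+1) ^~ w))
  (objective_smooth_convex fG oracle)
  (fun i => exprn_ge0 i r0) W0.
rewrite -/W /excess mulrBr; under [\sum_(i < m) _ * (_ - _)]eq_bigr do rewrite mulrBr.
by rewrite sumrB -mulr_suml -/W lerD2r.
Qed.

Lemma stage_contraction s : (s < S)%N -> 0 <= 1 - mu * eta ->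
  dist s.+1 + 3 / 2 * (eta * W * ref_excess s.+1) <=
  (1 - mu * eta) ^+ m * dist s + 1 / 2 * (eta * W * ref_excess s).
Proof.
move=> sS r0.
have := geometric_unroll r0 (fun t tm => potential_step sS tm).
rewrite potential0; have := dist_le_potential sS.
have := ler_wpM2l (ltW eta0) (ref_excess_jensen sS r0).
under [\sum_(i < m) _ * (_ - _)]eq_bigr do rewrite mulrBr.
rewrite sumrB -mulr_suml.
have -> : \sum_(i < m) (1 - mu * eta) ^+ (m - i.+1) = W.
  rewrite (reindex_inj rev_ord_inj) /=; apply: eq_bigr => i _.
  by rewrite subnSK// subKn// ltnW.
under [\sum_(i < m) _ * (3 / 2 * eta * _)]eq_bigr do rewrite mulrCA.
rewrite -mulr_sumr; lra.
Qed.

Lemma expectation_output_convex : mu = 0 -> (0 < S)%N ->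
  \int[P]_w excess (output D f mu eta S m I xi X w) <=
  (dist 0 / (eta * m%:R) + 1 / 2 * ref_excess 0) / S%:R.
Proof.
move=> muE S0; have r0 : 0 <= 1 - mu * eta by rewrite muE mul0r subr0.
have WE : W = m%:R.
  rewrite /W muE mul0r subr0; under eq_bigr do rewrite expr1n.
  by rewrite sumr_const card_ord.
have tele s : (s < S)%N -> dist s.+1 + 3 / 2 * (eta * W * ref_excess s.+1) <=
    dist s + 1 / 2 * (eta * W * ref_excess s).
  move=> sS; apply: (le_trans (stage_contraction sS r0)).
  by rewrite muE mul0r subr0 expr1n mul1r.
have S0R : 0 < S%:R :> R by rewrite ltr0n.
have mR0 : 0 < m%:R :> R by rewrite ltr0n.
have SE : \sum_(i < S) 1 = S%:R :> R by rewrite sumr_const card_ord.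
have ie (i : 'I_S) : P.-integrable setT (EFin \o (fun w => excess (ref_at i.+1 w))).
  apply: (integrable_excess P L0 fG oracle xs_min) => //.
  exact: (adapted_vmeasurable hs (a_ref (ltn_ord i))).
have [isum sumE] := integrable_Rintegral_sum (index_enum 'I_S) ie.
(* The uniform average is written with unit weights to fit the weighted Jensen inequality. *)
have outE w : output D f mu eta S m I xi X w =
    (\sum_(i < S) 1)^-1 *: \sum_(i < S) 1 *: ref_at i.+1 w.
  rewrite outputE (introT eqP muE) SE; congr (_ *: _).
  by apply: eq_bigr => i _; rewrite scale1r.
have iout : P.-integrable setT (EFin \o (fun w =>
    excess (output D f mu eta S m I xi X w))).
  apply: (integrable_excess P L0 fG oracle xs_min).
    exact: (vmeasurable_output mu eta I L0 fG oracle hs aX).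
  exact: (vbounded_output mu eta S m I xi L0 fG oracle bX).
rewrite ler_pdivlMr// mulrC.
apply: (@le_trans _ _ (\sum_(i < S) ref_excess i.+1)).
  rewrite -sumE -RintegralZl//; apply: le_Rintegral => //.
    exact: (integrableZl measurableT _ iout).
  move=> w _; rewrite outE.
  have := smooth_convex_jensen (c := fun=> 1) (fun i : 'I_S => ref_at i.+1 w)
    (objective_smooth_convex fG oracle) (fun=> ler01).
  rewrite SE => /(_ S0R) jensen.
  rewrite /excess mulrBr sumrB [X in _ <= _ - X]sumr_const card_ord.
  rewrite -[X in _ <= _ - X]mulr_natl lerD2r.
  by apply: (le_trans jensen); apply: ler_sum => i _; rewrite mul1r.
have := @telescope_bound _ dist (fun s => eta * W * ref_excess s) S tele.
rewrite -mulr_sumr big_add1 big_mkord WE => h.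
have em0 : 0 < eta * m%:R by rewrite mulr_gt0.
rewrite -(ler_pM2l em0) mulrDr mulrCA divff ?gt_eqF// mulr1.
have d0 : 0 <= dist S by apply: Rintegral_ge0 => w _; exact: sqn_ge0.
have e0 : 0 <= eta * m%:R * ref_excess S.
  by rewrite mulr_ge0 ?(ltW em0)//; apply: Rintegral_ge0 => w _; exact: excess_ge0.
rewrite /= in h; lra.
Qed.

(** The recurrence is divided by [eta * W]; as [W >= 1], the distance term is at most
    [dist 0 / eta]. *)
Lemma expectation_output_strong rho : mu != 0 -> 0 <= 1 - mu * eta ->
  (1 - mu * eta) ^+ m <= rho -> 1 / 3 <= rho ->
  \int[P]_w excess (output D f mu eta S m I xi X w) <=
  rho ^+ S * (dist 0 / eta + ref_excess 0).
Proof.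
move=> mu1 r0 rrho rho3; have W1 := sum_weights_ge1 r0.
have W0 : 0 < eta * W by rewrite mulr_gt0// (lt_le_trans ltr01).
have d0 s : 0 <= dist s by apply: Rintegral_ge0 => w _; exact: sqn_ge0.
have e0 s : 0 <= ref_excess s by apply: Rintegral_ge0 => w _; exact: excess_ge0.
have b0 s : 0 <= eta * W * ref_excess s by rewrite mulr_ge0// ltW.
have := linear_rate_bound rrho rho3 (fun s _ => d0 s) (fun s _ => b0 s)
  (fun s sS => stage_contraction sS r0).
rewrite outputE (negbTE mu1) -/(ref_excess S) => h.
rewrite -(ler_pM2l W0) mulrCA.
have rho0 : 0 <= rho ^+ S by rewrite exprn_ge0//; lra.
have h1 : dist 0 <= eta * W * (dist 0 / eta).
  have -> : eta * W * (dist 0 / eta) = W * dist 0 by field; rewrite gt_eqF.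
  by rewrite ler_peMl.
have := ler_wpM2l rho0 h1; have := mulr_ge0 rho0 (d0 0%N); have := d0 S.
lra.
Qed.

End StageAnalysis.

(** * Truncation of the initial point *)

Section Truncation.
Context {R : realType} {n d : nat} {dX dO : measure_display}.
Context {Xi : 'I_n.+1 -> measurableType dX} {Omega : measurableType dO}.
Variables (P : probability Omega R) (S m : nat) (xs : 'rV[R]_d) (B : R).
Variables (x0 : Omega -> 'rV[R]_d) (xi : forall k, nat -> nat -> Omega -> Xi k).

Lemma measurable_coord_borel i :
  measurable_fun setT (fun x : borel_rV R d => (x : 'rV[R]_d) 0 i).
Proof.
apply: (measurability (@RGenOInfty.G R)); first exact: RGenOInfty.measurableE.
move=> _ [_ [x ->] <-]; rewrite setTI; apply: sub_sigma_algebra.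
by apply: open_comp => [y _|]; [exact: coord_continuous|exact: rray_open].
Qed.

Lemma adapted_initial : adapted S m x0 xi 0 0 x0.
Proof.
move=> i _ A mA; rewrite setTI; apply: sub_sigma_algebra.
apply: (@source_past _ _ _ _ _ _ _ S m x0 xi 0 0 None) => //.
exists ((fun x : borel_rV R d => (x : 'rV[R]_d) 0 i) @^-1` A); last by rewrite setTI.
by rewrite -[X in measurable X]setTI; exact: measurable_coord_borel.
Qed.

(** Turns the almost sure distance bound into a sure one, while depending on the initial point alone
    and so remaining adapted. *)
Definition truncate w := if sqn (x0 w - xs) <= B ^+ 2 then x0 w else xs.

Lemma adapted_truncate : adapted S m x0 xi 0 0 truncate.
Proof.
move=> i; have a0 := adapted_initial.
have -> : (fun w => truncate w 0 i) =
    (fun w => if sqn (x0 w - xs) <= B ^+ 2 then x0 w 0 i else xs 0 i).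
  by apply: funext => w; rewrite /truncate; case: ifP.
apply: (@measurable_fun_ifT _ _ (pastT S m x0 xi 0 0)).
- apply: measurable_fun_ler; last exact: measurable_cst.
  by apply: measurable_sqn; apply: vmeasurableB; last exact: vmeasurable_cst.
- exact: a0.
- exact: measurable_cst.
Qed.

Lemma sqn_truncate w : sqn (truncate w - xs) <= B ^+ 2.
Proof. by rewrite /truncate; case: ifP => // _; rewrite subrr sqn0 sqr_ge0. Qed.

Lemma vbounded_truncate : vbounded truncate.
Proof.
have : vbounded (fun w => truncate w - xs) by exists (B ^+ 2); exact: sqn_truncate.
move=> /vboundedD /(_ (vbounded_cst xs)).
by under eq_fun do rewrite subrK.
Qed.

Lemma truncate_ae : {ae P, forall w, enorm (x0 w - xs) <= B} ->
  {ae P, forall w, truncate w = x0 w}.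
Proof.
apply: filterS => w xB; rewrite /truncate -sqr_enorm ifT//.
by rewrite lerXn2r ?nnegrE ?sqrtr_ge0// (le_trans (sqrtr_ge0 _) xB).
Qed.

End Truncation.

Lemma expectation_ae_bounded {R : realType} {d} {T : measurableType d}
    (P : probability T R) (h g : T -> R) :
  measurable_fun setT h -> measurable_fun setT g -> rbounded g ->
  {ae P, forall w, h w = g w} -> ('E_P[h] = (\int[P]_w g w)%:E)%E.
Proof.
move=> mh mg bg hg; rewrite unlock.
rewrite (ae_eq_integral (EFin \o g))//=; first last.
- by apply: filterS hg => w /= -> _.
- exact/measurable_EFinP.
- exact/measurable_EFinP.
by rewrite fineK// integrable_fin_num//; exact: bounded_integrable.
Qed.

(** The upper and lower quadratic bounds are compared at two distinct points, which requires
    positive dimension. *)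
Lemma convex_smooth_mu_le {R : realType} {d : nat} (L mu : R) (g : 'rV[R]_d.+1 -> R) G :
  smooth_convex L g G ->
  (forall x y, dotp (G x) (y - x) + mu / 2 * sqn (x - y) <= g y - g x) ->
  mu <= 2 * L.
Proof.
move=> sG scG; pose u : 'rV[R]_d.+1 := const_mx 1.
have u0 : 0 < sqn u.
  rewrite lt_neqAle sqn_ge0 andbT; apply/eqP => /esym u0.
  have /rowP/(_ 0) : u = 0 by apply: sqn_eq0; rewrite u0.
  by rewrite !mxE => /eqP; rewrite oner_eq0.
have := scG 0 u; have /andP[_] := sG 0 u; rewrite sqnBC subr0 => h1 h2.
have : mu / 2 * sqn u <= L * sqn u by lra.
by rewrite ler_pM2r//; lra.
Qed.

(** * The exponential rate and the final theorem *)

Section Rates.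
Context {R : realType}.

(** The first bound is [1 - x <= exp (- x)]. Using the maximum [M] instead of [kappa E] keeps the
    exponent per stage at most [c], hence [rho >= 1 - c >= 1 / 3]. *)
Lemma expR_step_bound (mu eta E L c : R) (m S : nat) :
  0 < L -> 0 < mu -> 0 < E -> (0 < m)%N -> 0 < c <= 1 / 2 ->
  eta = c / (L * E) -> mu * eta <= 1 ->
  let M := Num.max (L / mu * E) m%:R in
  let rho := expR (- (c * (m%:R / M))) in
  [/\ (1 - mu * eta) ^+ m <= rho, 1 / 3 <= rho
    & rho ^+ S = expR (- (c * ((m * S)%:R / M)))].
Proof.
move=> L0 mu0 E0 m0 /andP[c0 c1] etaE me1 M rho.
have m0R : 0 < m%:R :> R by rewrite ltr0n.
have M0 : 0 < M by rewrite lt_max m0R orbT.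
have kM : L / mu * E <= M by rewrite le_max lexx.
have mM : m%:R <= M by rewrite le_max lexx orbT.
have k0 : 0 < L / mu * E by rewrite !mulr_gt0// invr_gt0.
split.
- apply: (@le_trans _ _ (expR (- (mu * eta)) ^+ m)).
    by rewrite lerXn2r ?nnegrE ?subr_ge0 ?expR_ge0// expR_ge1Dx.
  rewrite -expRM_natl ler_expR mulrN lerN2.
  have -> : m%:R * (mu * eta) = c * (m%:R / (L / mu * E)).
    by rewrite etaE; field; rewrite !gt_eqF.
  by rewrite ler_wpM2l ?(ltW c0)// ler_wpM2l ?(ltW m0R)// lef_pV2.
- apply: le_trans (expR_ge1Dx _).
  have : c * (m%:R / M) <= c.
    by rewrite ler_piMr ?(ltW c0)// ler_pdivrMr// mul1r.
  lra.
- rewrite -expRM_natl mulrN natrM; congr (expR (- _)).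
  by ring.
Qed.

End Rates.

Theorem corollary6p2 (R : realType) :
  exists c0 C c1 : R, [/\ 0 < c0, 0 < C & 0 < c1] /\
  forall (n d m S E : nat) (I : pred nat)
    (Lk muk : 'I_n.+1 -> R) (B F : R),
  (0 < S)%N ->
  (1 <= E <= m)%N ->
  (forall t, I t -> (1 <= t <= m)%N) ->
  gap m I = E ->
  (forall k, 0 <= Lk k) ->
  (forall k, 0 <= muk k) ->
  let L := \big[Num.max/Lk ord0]_k Lk k in
  let mu := \big[Num.min/muk ord0]_k muk k in
  let kappa := L / mu in
  let T : R := (m * S)%:R in
  exists eta : R, [/\ 0 < eta, eta * (L * E%:R) <= c0 &
  forall (dX dO : measure_display)
    (Xi : 'I_n.+1 -> measurableType dX)
    (D : forall k, probability (Xi k) R)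
    (f : forall k, 'rV[R]_d -> Xi k -> R)
    (xstar : 'rV[R]_d)
    (Omega : measurableType dO) (P : probability Omega R)
    (x0 : Omega -> 'rV[R]_d)
    (xi : forall k, nat -> nat -> Omega -> Xi k),
  (forall k (z : Xi k), convex_smooth (Lk k) (fun x => f k x z)) ->
  (forall k, stochastic_oracle D f k) ->
  (forall k, strongly_convex (muk k) (local_objective D f k)) ->
  minimizer (objective D f) xstar ->
  independent_sampling P D S m x0 xi ->
  {ae P, forall w, enorm (x0 w - xstar) <= B} ->
  ('E_P[(fun w => objective D f (x0 w) - objective D f xstar)%R])%E = F%:E ->
  let xhat w :=
    svrg_output D f m I mu eta S (x0 w) (fun k s t => xi k s t w) in
  let err := ('E_P[(fun w => objective D f (xhat w) - objective D f xstar)%R])%E in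
  (mu = 0 ->
     (err <= (C * (L * E%:R * B ^+ 2 / T + F / S%:R))%R%:E)%E)
  /\
  (0 < mu ->
     (err <= (C * ((L * E%:R * B ^+ 2 + F)
                * expR (- (c1 * (T / Num.max (kappa * E%:R) m%:R)))))%R%:E)%E)].
Proof.
(* The bound on [c] is the step-size condition of the one-step estimate; [1 / c] arises from
   dividing the squared distance by [eta]. *)
have [c [c0 c1]] : exists c : R, 0 < c /\ 1000 * c <= 1.
  by exists (1 / 1000); split; lra.
have C1 : 1 <= c^-1 by rewrite -[leLHS]invr1 lef_pV2 ?posrE//; lra.
exists c, c^-1, c; split; first by split; rewrite ?invr_gt0.
move=> n d m S E I Lk muk B F S0 /andP[E1 Em] _ gapE Lk0 muk0 L mu kappa T.
have L_ge k : Lk k <= L by exact: le_bigmax.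
have mu_le k : mu <= muk k by exact: bigmin_le.
have L0 : 0 <= L := le_trans (Lk0 ord0) (L_ge ord0).
have mu0 : 0 <= mu.
  by rewrite /mu; elim/big_ind: _ => // x y x0 y0; rewrite le_min x0.
have m0 : (0 < m)%N := leq_trans E1 Em.
have ER0 : 0 < E%:R :> R by rewrite ltr0n.
have T0 : 0 < T by rewrite ltr0n muln_gt0 m0.
(* If [L = 0] the objective will be shown constant, so any positive value serves. *)
pose eta := if L == 0 then 1 else c / (L * E%:R).
exists eta; split.
- rewrite /eta; case: eqVneq => // Ln0.
  by rewrite divr_gt0// mulr_gt0// lt_neqAle eq_sym Ln0.
- rewrite /eta; case: eqVneq => [->|Ln0]; first by rewrite mul0r mulr0 ltW.
  by rewrite divfK// mulf_neq0// gt_eqF.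
move=> dX dO Xi D f xs Omega P x0 xi fsm orc str xs_min hs xB EF xhat err.
have strong k : strongly_convex mu (local_objective D f k).
  move=> x y; apply: le_trans (str k x y).
  by rewrite lerD2l ler_wpM2r ?sqr_ge0// ler_wpM2r// invr_ge0.
have smooth L' : 0 < L' -> L <= L' -> forall k (z : Xi k),
    smooth_convex L' (fun x => f k x z) (fun x => sample_gradient f x z).
  move=> L'0 LL' k z; apply: convex_smooth_smooth_convex (fsm k z) => //.
  by rewrite Lk0 (le_trans (L_ge k)).
have LEB0 : 0 <= L * E%:R * B ^+ 2 by rewrite mulr_ge0 ?sqr_ge0// mulr_ge0.
(* Covers the degenerate cases [L = 0] and dimension 0, where the error and [F] vanish. *)
have trivial : (forall x, objective D f x - objective D f xs = 0) ->
    (mu = 0 -> (err <= (c^-1 * (L * E%:R * B ^+ 2 / T + F / S%:R))%R%:E)%E) /\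
    (0 < mu -> (err <= (c^-1 * ((L * E%:R * B ^+ 2 + F) *
      expR (- (c * (T / Num.max (kappa * E%:R) m%:R)))))%R%:E)%E).
  move=> ex0; have err0 : err = 0%E.
    rewrite /err -[RHS](expectation_cst P 0); congr expectation.
    by apply: funext => w; exact: ex0.
  have F0 : F = 0.
    apply: EFin_inj; rewrite -EF -[RHS](expectation_cst P 0); congr expectation.
    by apply: funext => w; exact: ex0.
  rewrite err0 F0 mul0r !addr0; split=> _; rewrite lee_fin.
    by rewrite mulr_ge0 ?(le_trans ler01 C1)// divr_ge0// ltW.
  by rewrite mulr_ge0 ?(le_trans ler01 C1)// mulr_ge0// expR_ge0.
have [L00|Ln0] := eqVneq L 0.
  apply: trivial => x; apply/eqP; rewrite eq_le (excess_ge0 xs_min) andbT.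
  (* When [L = 0] the quadratic bounds hold with every positive constant; this one makes the excess
     at [x] at most [e]. *)
  apply/ler_addgt0Pr => e e0; rewrite add0r; pose L' := e / (1 + sqn (x - xs)).
  have s0 : 0 < 1 + sqn (x - xs) by rewrite ltr_pwDl// sqn_ge0.
  have L'0 : 0 < L' by rewrite divr_gt0.
  have sm : forall k (z : Xi k),
      smooth_convex L' (fun x => f k x z) (fun x => sample_gradient f x z).
    by apply: smooth => //; rewrite L00 ltW.
  apply: (le_trans (excess_le L'0 sm orc xs_min x)).
  by rewrite /L' mulrAC ler_pdivrMr// ler_pM2l// lerDr.
have {}L0 : 0 < L by rewrite lt_neqAle eq_sym Ln0.
have {}smooth := smooth L L0 (lexx L).
(* In dimension 0 there is a single point, and [mu <= 2 L] may fail. *)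
case: d => [|d] in f xs x0 xi fsm orc str xs_min hs xB EF xhat err strong smooth trivial *.
  by apply: trivial => x; rewrite (_ : x = xs) ?subrr//; apply/rowP => -[].
have muL : mu <= 2 * L.
  apply: (convex_smooth_mu_le (local_objective_smooth_convex smooth orc ord0)) => x y.
  by rewrite -sqr_enorm; exact: strong.
have etaE : eta = c / (L * E%:R) by rewrite /eta (negbTE Ln0).
have eta0 : 0 < eta by rewrite etaE divr_gt0// mulr_gt0.
have etaLE : eta * L * E%:R = c.
  by rewrite etaE; field; rewrite !gt_eqF.
have E1' : (1 <= gap m I)%N by rewrite gapE.
have etaLE' : 1000 * (eta * L * (gap m I)%:R) <= 1 by rewrite gapE etaLE.
pose X := truncate xs B x0.
have aX : adapted S m x0 xi 0 0 X  by exact: adapted_truncate.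
have bX : vbounded X  by exact: vbounded_truncate.
have Xx0 : {ae P, forall w, X w = x0 w}  by exact: truncate_ae.
have ax0 : adapted S m x0 xi 0 0 x0  by exact: adapted_initial.
have FE : F = \int[P]_w excess D f xs (X w).
  apply: EFin_inj; rewrite -EF; apply: expectation_ae_bounded.
  - exact: (measurable_excess xs L0 smooth orc (adapted_vmeasurable hs ax0)).
  - exact: (measurable_excess xs L0 smooth orc (adapted_vmeasurable hs aX)).
  - exact: (rbounded_excess L0 smooth orc xs_min bX).
  - by apply: filterS Xx0 => w /= ->.
pose Y := output D f mu eta S m I xi X.
have errE : err = (\int[P]_w excess D f xs (Y w))%:E.
  apply: expectation_ae_bounded.
  - exact: (measurable_excess xs L0 smooth orc
      (vmeasurable_output mu eta I L0 smooth orc hs ax0)).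
  - exact: (measurable_excess xs L0 smooth orc
      (vmeasurable_output mu eta I L0 smooth orc hs aX)).
  - exact: (rbounded_excess L0 smooth orc xs_min
      (vbounded_output mu eta S m I xi L0 smooth orc bX)).
  - by apply: filterS Xx0 => w /= Xw; rewrite /Y /output Xw.
have distB : dist P D f mu eta m I xs xi X 0 <= B ^+ 2.
  have Bnd w : `|sqn (X w - xs)| <= B ^+ 2.
    by rewrite ger0_norm ?sqn_ge0// sqn_truncate.
  apply: (le_trans (ler_norm _)); apply: Rintegral_norm_le => //.
  apply: measurable_sqn; apply: vmeasurableB; last exact: vmeasurable_cst.
  exact: (adapted_vmeasurable hs aX).
have F0 : 0 <= F.
  by rewrite FE; apply: Rintegral_ge0 => w _; exact: excess_ge0.
have S0R : 0 < S%:R :> R by rewrite ltr0n.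
have m0R : 0 < m%:R :> R by rewrite ltr0n.
rewrite errE; split => mu1; rewrite lee_fin.
  apply: (le_trans (expectation_output_convex L0 mu0 muL eta0 E1' etaLE' m0 smooth
    orc strong xs_min hs aX bX mu1 S0)).
  rewrite /ref_excess /= -FE.
  apply: (@le_trans _ _ ((B ^+ 2 / (eta * m%:R) + 1 / 2 * F) / S%:R)).
    by rewrite ler_pM2r ?invr_gt0// lerD2r ler_pM2r// invr_gt0 mulr_gt0.
  have -> : B ^+ 2 / (eta * m%:R) = c^-1 * (L * E%:R * B ^+ 2) / m%:R.
    by rewrite etaE; field; rewrite !gt_eqF.
  have -> : c^-1 * (L * E%:R * B ^+ 2 / T + F / S%:R) =
      (c^-1 * (L * E%:R * B ^+ 2) / m%:R + c^-1 * F) / S%:R.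
    by rewrite /T natrM; field; rewrite !gt_eqF.
  rewrite ler_pM2r ?invr_gt0// lerD2l ler_wpM2r//; move: C1; lra.
(* Indeed [mu * eta <= 2 * eta * L <= 2 * c]. *)
have me1 : mu * eta <= 1.
  have := ler_wpM2r (ltW eta0) muL.
  have : eta * L <= eta * L * E%:R.
    by rewrite ler_peMr ?ler1n// mulr_ge0// ltW.
  rewrite etaLE; move: c1; lra.
have c01 : 0 < c <= 1 / 2 by rewrite c0 /=; move: c1; lra.
have [r1 r2 r3] := expR_step_bound S L0 mu1 ER0 m0 c01 etaE me1.
have r0 : 0 <= 1 - mu * eta by rewrite subr_ge0.
apply: (le_trans (expectation_output_strong L0 mu0 muL eta0 E1' etaLE' m0 smooth
  orc strong xs_min hs aX bX (lt0r_neq0 mu1) r0 r1 r2)).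
rewrite r3 /ref_excess /= -FE -/T -/kappa mulrC mulrA ler_wpM2r ?expR_ge0//.
apply: (@le_trans _ _ (B ^+ 2 / eta + F)).
  by rewrite lerD2r ler_pM2r// invr_gt0.
have -> : B ^+ 2 / eta = c^-1 * (L * E%:R * B ^+ 2).
  by rewrite etaE; field; rewrite !gt_eqF.
by rewrite mulrDr lerD2l ler_peMl.
Qed.
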